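(* Let $r\ge1$, $n\ge2r$, let $Z_1,\dots,Z_n$ be i.i.d. copies of a random variable $Z$ with values in $\mathcal Z$, let $h:\mathcal Z^r\to\mathbb R$ be a symmetric kernel with $\mathbb E\{h(Z_1,\dots,Z_r)^2\}<\infty$, and let $H\in\mathcal V_{n,r}$ be the array $H_I=h(Z_I)$, $I\in\mathcal I_{n,r}$. Then the overlap-based estimator $$\widehat\sigma^2_{r,n}:=T^{\mathrm{dir}}_{n,r}=\sum_{s=0}^r(-1)^{r-s}\binom rs\frac1{N_{n,r,s}}\sum_{I,J\in\mathcal I_{n,r},\,|I\cap J|=s}H_IH_J$$ satisfies $$\widehat\sigma^2_{r,n}=\frac1{d_{n,r}}\|\mathcal U_{n,r}H\|^2 .$$ Its expectation is $\mathbb E\,\widehat\sigma^2_{r,n}=\sigma_r^2$, where $\sigma_r^2=\mathbb E\{h_r(Z_1,\dots,Z_r)^2\}$ is the variance of the highest-order Hoeffding component $h_r$ of $h$, and $\widehat\sigma^2_{r,n}\ge0$.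
   Context: $[n]=\{1,\dots,n\}$; $\mathcal I_{n,r}$ is the set of $r$-element subsets of $[n]$; for $I=\{i_1<\dots<i_r\}$, $Z_I=(Z_{i_1},\dots,Z_{i_r})$. $\mathcal V_{n,r}=\mathbb R^{\mathcal I_{n,r}}$ with $\langle A,B\rangle=\sum_IA_IB_I$ and $\|A\|^2=\langle A,A\rangle$. With $(D_{j,r}A)(J)=\sum_{I\in\mathcal I_{n,r},\,I\supseteq J}A_I$ for $J\subseteq[n]$, $|J|=j$, and $(D_{j,r}^*f)(I)=\sum_{J\subseteq I,\,|J|=j}f(J)$, $$\mathcal U_{n,r}A=\sum_{j=0}^r\frac{(-1)^{r-j}}{\binom{n-r-j+1}{r-j}}D_{j,r}^*D_{j,r}A,\qquad d_{n,r}=\binom nr-\binom n{r-1},\qquad N_{n,r,s}=\binom nr\binom rs\binom{n-r}{r-s}.$$ Hoeffding components of $h$: $g_j(z_1,\dots,z_j)=\mathbb E\{h(z_1,\dots,z_j,Z_{j+1},\dots,Z_r)\}$ for $0\le j\le r$, $h_0=g_0$, and recursively $h_j(z_1,\dots,z_j)=g_j(z_1,\dots,z_j)-\sum_{\ell=0}^{j-1}\sum_{S\subseteq[j],|S|=\ell}h_\ell(z_S)$, where $z_S=(z_{s_1},\dots,z_{s_\ell})$ for $S=\{s_1<\dots<s_\ell\}$ and $h_0(z_\varnothing)=h_0$. *)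

(* Defs.v *)
From HB Require Import structures.
From mathcomp Require Import all_boot all_order all_algebra all_fingroup.
From mathcomp Require Import all_classical all_reals all_analysis.

Set Implicit Arguments.
Unset Strict Implicit.
Unset Printing Implicit Defensive.

Import Order.TTheory GRing.Theory Num.Theory.

Local Open Scope ring_scope.

Lemma leq_double_l (r n : nat) : (2 * r <= n)%N -> (r <= n)%N.
Proof. by apply: leq_trans; rewrite mul2n -addnn leq_addr. Qed.

Section Arrays.

(* The r-element subsets of [n] = {0, ..., n-1}. *)
Definition subsets (n r : nat) := {I : {set 'I_n} | #|I| == r}.

(* The elements i_1 < ... < i_r of I: [enum] lists ordinals increasingly. *)
Definition indices (n r : nat) (I : subsets n r) : r.-tuple 'I_n :=
  tcast (eqP (valP I)) (enum_tuple (val I)).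

(* z_I = (z_{i_1}, ..., z_{i_r}) *)
Definition restrict (T : Type) (n r : nat) (z : n.-tuple T) (I : subsets n r)
  : r.-tuple T := [tuple tnth z (tnth (indices I) k) | k < r].

Context {R : realType}.

Definition array (n r : nat) := {ffun subsets n r -> R}.

Definition dot (n r : nat) (A B : array n r) : R := \sum_I A I * B I.

Definition sqnorm (n r : nat) (A : array n r) : R := dot A A.

Definition down (n r j : nat) (A : array n r) : array n j :=
  [ffun J : subsets n j =>
    \sum_(I : subsets n r | val J \subset val I) A I].

Definition down_adj (n r j : nat) (f : array n j) : array n r :=
  [ffun I : subsets n r =>
    \sum_(J : subsets n j | val J \subset val I) f J].

(* The natural-number subtraction in n - r - j + 1 does not truncate when
   j <= r and 2 r <= n. *)
Definition Uop (n r : nat) (A : array n r) : array n r :=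
  [ffun I : subsets n r =>
    \sum_(j < r.+1) (-1) ^+ (r - j) / ('C(n - r - j + 1, r - j))%:R
                    * down_adj r (down j A) I].

(* Only meant for 1 <= r: the predecessor truncates at r = 0. *)
Definition dimd (n r : nat) : R := ('C(n, r))%:R - ('C(n, r.-1))%:R.

Definition npairs (n r s : nat) : nat :=
  ('C(n, r) * 'C(r, s) * 'C(n - r, r - s))%N.

Definition Tdir (n r : nat) (H : array n r) : R :=
  \sum_(s < r.+1) (-1) ^+ (r - s) * ('C(r, s))%:R * (npairs n r s)%:R^-1
    * \sum_(I : subsets n r)
        \sum_(J : subsets n r | #|val I :&: val J| == s) H I * H J.

End Arrays.

Arguments array R n r : clear implicits.
Arguments dimd R n r : clear implicits.

Section Probability.
Context {d dS : measure_display} {Omega : measurableType d}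
  {S : measurableType dS} {R : realType} {P : probability Omega R}.

Definition mutually_independent (n : nat) (Z : 'I_n -> {RV P >-> S}) : Prop :=
  forall (K : {set 'I_n}) (B : 'I_n -> set S),
    (forall i, measurable (B i)) ->
    P (\bigcap_(i in [set` K]) Z i @^-1` B i)%classic =
    (\prod_(i in K) P (Z i @^-1` B i)%classic)%E.

Definition iid_copies (d0 : measure_display) (Omega0 : measurableType d0)
    (P0 : probability Omega0 R) (Z0 : {RV P0 >-> S})
    (n : nat) (Z : 'I_n -> {RV P >-> S}) : Prop :=
  mutually_independent Z /\
  forall (i : 'I_n) (B : set S), measurable B ->
    distribution P (Z i) B = distribution P0 Z0 B.

Definition sample (n : nat) (Z : 'I_n -> {RV P >-> S}) (w : Omega)
  : n.-tuple S := [tuple Z i w | i < n].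

Section Hoeffding.
Variables (r : nat) (Z : 'I_r -> {RV P >-> S}) (h : r.-tuple S -> R).

(* g_j(z_1, ..., z_j) = E h(z_1, ..., z_j, Z_{j+1}, ..., Z_r): the default
   value of [nth] supplies Z_{i+1} at the positions i >= j = size z.  Where the
   expectation is undefined or infinite (a null set when h(Z_1, ..., Z_r) is
   integrable), [fine] yields a junk value. *)
Definition gproj (j : nat) (z : j.-tuple S) : R :=
  fine ('E_P[fun w => h [tuple nth (Z i w) z i | i < r]])%E.

(* The first argument is fuel; j.+1 units suffice, see hoeffdingE. *)
Fixpoint hoeffding_rec (m j : nat) (z : j.-tuple S) : R :=
  if m is m'.+1 then
    gproj z - \sum_(l < j) \sum_(I : subsets j l)
                hoeffding_rec m' (restrict z I)
  else 0.

Definition hoeffding (j : nat) (z : j.-tuple S) : R := hoeffding_rec j.+1 z.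

Lemma hoeffding_rec_fuel (m j : nat) (z : j.-tuple S) :
  (j < m)%N -> hoeffding_rec m z = hoeffding z.
Proof.
have H k : forall (a b i : nat) (y : i.-tuple S), (i < k)%N -> (i < a)%N ->
    (i < b)%N -> hoeffding_rec a y = hoeffding_rec b y.
  elim: k => // k IH [//|a] [//|b] i y ik ia ib /=.
  congr (_ - _); apply: eq_bigr => l _; apply: eq_bigr => I _.
  by apply: IH; apply: leq_trans (ltn_ord l) _; rewrite -ltnS.
by move=> jm; apply: (H j.+1).
Qed.

Lemma hoeffdingE (j : nat) (z : j.-tuple S) :
  hoeffding z = gproj z - \sum_(l < j) \sum_(I : subsets j l)
                            hoeffding (restrict z I).
Proof.
rewrite {1}/hoeffding /=; congr (_ - _).
apply: eq_bigr => l _; apply: eq_bigr => I _.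
exact: hoeffding_rec_fuel.
Qed.

End Hoeffding.

Definition kernel_array (n r : nat) (Z : 'I_n -> {RV P >-> S})
    (h : r.-tuple S -> R) (w : Omega) : array R n r :=
  [ffun I : subsets n r => h (restrict (sample Z w) I)].

Definition sigma2_hat (n r : nat) (Z : 'I_n -> {RV P >-> S})
    (h : r.-tuple S -> R) (w : Omega) : R := Tdir (kernel_array Z h w).

End Probability.

Definition symmetric_kernel (S V : Type) (r : nat) (h : r.-tuple S -> V)
  : Prop :=
  forall (s : 'S_r) (z : r.-tuple S), h [tuple tnth z (s i) | i < r] = h z.

(* Main.v *)
Require Import Defs.
From mathcomp Require Import all_boot all_order all_algebra all_fingroup.
From mathcomp Require Import all_classical all_reals all_analysis.
From mathcomp Require Import measurable_realfun zify ring lra.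

(** The entry [(U)_{IJ}] depends only on [s = |I n J|], and a Beta-integral
identity for alternating sums of inverse binomials evaluates it to
[(d / C(n,r)) (-1)^(r-s) / C(n-r,r-s)], which is [d] times the weight of
[H_I H_J] in [Tdir].  This closed form makes all sums of [U A] over the
[r]-sets containing a given [j]-set, [j < r], vanish, so that [U U A = U A];
since [U] is symmetric, [|U H|^2 = <H, U H> = d Tdir H].

For the expectation, the mean of [h(Z_I) h(Z_J)] is a function [theta] of
[|I n J|] only, and Fubini on three independent copies of the sample gives
[E g(Z_A) g(Z_B) = theta(|A n B|)] for the projections [g_j].  By Moebius
inversion [h_r = sum_A (-1)^(r-|A|) g(Z_A)], and in the resulting double sum
for [E h_r^2] toggling one element outside [A] in [B] cancels every term with
[A <> [r]]; what remains is the mean of [Tdir]. *)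

Set Implicit Arguments.
Unset Strict Implicit.
Unset Printing Implicit Defensive.

Import Order.TTheory GRing.Theory Num.Theory.
Import numFieldNormedType.Exports.

(** * The projection onto the top Johnson component *)

Section InverseBinomial.
Variable R : numFieldType.
Local Open Scope ring_scope.

(** Pascal's rule turns an alternating sum of order s+1 into a difference of two sums of order s;
    this drives the induction on [s] below. *)
Lemma alternating_binomialS (f : nat -> R) (s : nat) :
  \sum_(j < s.+2) (-1) ^+ j * 'C(s.+1, j)%:R * f (s.+1 - j)%N =
  \sum_(j < s.+1) (-1) ^+ j * 'C(s, j)%:R * f (s - j).+1 -
  \sum_(j < s.+1) (-1) ^+ j * 'C(s, j)%:R * f (s - j)%N.
Proof.
rewrite big_ord_recl /= bin0 subn0.
under eq_bigr => i _ do rewrite /bump /= add1n subSS binS natrD mulrDr mulrDl.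
rewrite big_split /= addrA; congr (_ + _).
  rewrite big_ord_recr /= (bin_small (ltnSn s)) mulr0 mul0r addr0.
  rewrite [RHS]big_ord_recl /= bin0 subn0; congr (_ + _).
  by apply: eq_bigr => i _; rewrite /bump /= add1n subnSK.
by rewrite -sumrN; apply: eq_bigr => i _; rewrite exprS; ring.
Qed.

(** The Beta value (m+1) B(k+1, m+1), which is the case s = 0 of the next sum. *)
Lemma inverse_binomialE (m k : nat) :
  ('C(m.+1 + k, k)%:R : R)^-1 = (m.+1 * k`! * m`!)%:R / (m.+1 + k)`!%:R.
Proof.
have f0 i : i`!%:R != 0 :> R by rewrite pnatr_eq0 -lt0n fact_gt0.
have c0 : 'C(m.+1 + k, k)%:R != 0 :> R.
  by rewrite pnatr_eq0 -lt0n bin_gt0 leq_addl.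
apply: (mulfI c0); rewrite divff // mulrA.
apply: (mulIf (f0 (m.+1 + k)%N)).
rewrite mul1r -mulrA mulVf // mulr1 -natrM; congr _%:R.
rewrite -(bin_fact (leq_addl m.+1 k)) addnK factS.
by rewrite (mulnC _ k`!) -!mulnA [(k`! * _)%N]mulnCA.
Qed.

(* The right-hand side is what (m+1) int_0^1 x^i (1-x)^m dx, the value of
   1/C(m+1+i, i), gives after summing the binomial expansion. *)
Lemma alternating_inverse_binomial (m s k : nat) :
  \sum_(j < s.+1) (-1) ^+ j * 'C(s, j)%:R
     * ('C(m.+1 + (k + (s - j)), k + (s - j))%:R : R)^-1 =
  (-1) ^+ s * (m.+1 * k`! * (m + s)`!)%:R / (m.+1 + k + s)`!%:R.
Proof.
elim: s k => [|s IH] k.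
  rewrite big_ord_recl big_ord0 /= bin0 expr0 subn0 !addn0 !mul1r addr0.
  exact: inverse_binomialE.
rewrite (alternating_binomialS
  (fun i => ('C(m.+1 + (k + i), k + i)%:R : R)^-1)).
under eq_bigr => j _ do rewrite -addSnnS.
rewrite !IH.
have f0 i : i`!%:R != 0 :> R by rewrite pnatr_eq0 -lt0n fact_gt0.
have -> : (m.+1 + k.+1 + s = (m.+1 + k + s).+1)%N by lia.
have -> : (m.+1 + k + s.+1 = (m.+1 + k + s).+1)%N by lia.
rewrite addnS (factS k) (factS (m + s)) exprS.
(* With q = m+1+k+s, the difference of the two induction values carries the factor (k+1) - (q+1) =
   -(m+s+1), which supplies the new sign and completes (m+s+1)!. *)
have e1 : (m + s).+1%:R = (m.+1 + k + s).+1%:R - k.+1%:R :> R.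
  by rewrite -natrB; [congr _%:R; lia | lia].
move: (m.+1 + k + s)%N e1 => q e1; rewrite (factS q).
have q0 : q.+1%:R != 0 :> R by rewrite pnatr_eq0.
rewrite !natrM e1.
move: (f0 q) q0.
move: (q.+1%:R) (k.+1%:R) (m.+1%:R) (q`!%:R) (k`!%:R) => x y z F G.
move=> F0 x0; field.
by rewrite F0 x0.
Qed.

End InverseBinomial.

Section BigSubsets.
Local Open Scope nat_scope.

Lemma big_subsets (V : Type) (idx : V) (op : Monoid.com_law idx) (n k : nat)
    (P : pred {set 'I_n}) (F : {set 'I_n} -> V) :
  \big[op/idx]_(I : subsets n k | P (val I)) F (val I) =
  \big[op/idx]_(I : {set 'I_n} | (#|I| == k) && P I) F I.
Proof.
rewrite [RHS](reindex_omap (val : subsets n k -> {set 'I_n}) insub); last first.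
  by move=> I /andP[kI _]; rewrite insubT.
by apply: eq_bigl => -[I kI] /=; rewrite insubT kI /= eqxx andbT.
Qed.

End BigSubsets.

(** * Entries, vanishing sums and idempotence of [Uop] *)

Section Johnson.
Local Open Scope ring_scope.
Variables (R : realType) (n r : nat).
Hypotheses (hr : (1 <= r)%N) (hn : (2 * r <= n)%N).

(* The entry of U at (I, J), as a function of s = |I n J|. *)
Definition top_coef (s : nat) : R :=
  (n - 2 * r).+1%:R / (n - r).+1%:R * (-1) ^+ (r - s) / 'C(n - r, r - s)%:R.

(** Terms with j > s vanish since C(s, j) = 0; the others form the alternating inverse-binomial sum
    with m = n - 2r and k = r - s. *)
Lemma top_coefE (s : nat) : (s <= r)%N ->
  \sum_(j < r.+1) (-1) ^+ (r - j) / 'C(n - r - j + 1, r - j)%:R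
    * 'C(s, j)%:R = top_coef s.
Proof.
move=> sr.
have [m mE] : exists m, m = (n - 2 * r)%N by exists (n - 2 * r)%N.
rewrite -(subnKC (sr : s.+1 <= r.+1)%N).
rewrite big_split_ord /= [X in _ + X]big1 ?addr0; last first.
  by move=> j _; rewrite (@bin_small s) ?mulr0 //= leq_addr.
transitivity ((-1) ^+ r * \sum_(j < s.+1) (-1) ^+ j * 'C(s, j)%:R
     * ('C(m.+1 + ((r - s) + (s - j)), (r - s) + (s - j))%:R : R)^-1).
  rewrite big_distrr /=; apply: eq_bigr => -[j /= js] _.
  have jr : (j <= r)%N by lia.
  have -> : (n - r - j + 1 = m.+1 + (r - s + (s - j)))%N by lia.
  have -> : (r - s + (s - j) = r - j)%N by lia.
  have -> : (-1) ^+ (r - j) = (-1) ^+ r * (-1) ^+ j :> R.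
    by rewrite -signr_odd oddB // signr_addb !signr_odd.
  by ring.
rewrite alternating_inverse_binomial /top_coef -mE.
have -> : (n - r = m + r)%N by lia.
have f0 i : i`!%:R != 0 :> R by rewrite pnatr_eq0 -lt0n fact_gt0.
have lerm : (r - s <= m + r)%N by lia.
have /(congr1 (fun x => x%:R : R)) := bin_fact lerm.
have -> : (m + r - (r - s) = m + s)%N by lia.
have -> : (m.+1 + (r - s) + s = (m + r).+1)%N by lia.
have -> : (-1) ^+ (r - s) = (-1) ^+ r * (-1) ^+ s :> R.
  by rewrite -signr_odd oddB // signr_addb !signr_odd.
rewrite factS !natrM => <-.
have b0 : 'C(m + r, r - s)%:R != 0 :> R by rewrite pnatr_eq0 -lt0n bin_gt0.
have n0 : (m + r).+1%:R != 0 :> R by rewrite pnatr_eq0.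
move: b0 n0 (f0 (r - s)%N) (f0 (m + s)%N).
move: ('C(_, _)%:R) (m.+1%:R) ((m + r).+1%:R) ((r - s)`!%:R) ((m + s)`!%:R).
move=> b x y F G b0 y0 F0 G0; field.
by rewrite b0 F0 G0 y0.
Qed.

(** For an (r-1)-set J and an r-set L meeting in t points, this is the sum over x outside J of the
    entries of U at (J + x, L): r - t of these x lie in L and n - 2r + 1 + t do not. It vanishes by
    (k+1) C(N, k+1) = (N-k) C(N, k), the two signs being opposite. *)
Lemma top_coef_rec (t : nat) : (t < r)%N ->
  top_coef t.+1 *+ (r - t) + top_coef t *+ (n - 2 * r + 1 + t) = 0.
Proof.
move=> tr; rewrite /top_coef.
have -> : (r - t = (r - t.+1).+1)%N by lia.
set k := (r - t.+1)%N; set N := (n - r)%N.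
have kN : (k < N)%N by lia.
have E := mul_bin_left N k.
have -> : (n - 2 * r + 1 + t = N - k)%N by lia.
have b0 : 'C(N, k)%:R != 0 :> R by rewrite pnatr_eq0 -lt0n bin_gt0 ltnW.
have b1 : 'C(N, k.+1)%:R != 0 :> R by rewrite pnatr_eq0 -lt0n bin_gt0.
have n0 : N.+1%:R != 0 :> R by rewrite pnatr_eq0.
move/(congr1 (fun x => x%:R : R)) : E; rewrite !natrM => E.
rewrite -!(mulr_natr (_ / _)) exprS.
have -> : (N - k)%:R = k.+1%:R * 'C(N, k.+1)%:R / 'C(N, k)%:R :> R.
  by rewrite E mulfK.
move: b0 b1 n0.
move: ('C(N, k)%:R) ('C(N, k.+1)%:R) (k.+1%:R) (N.+1%:R) ((n - 2 * r).+1%:R).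
by move=> b c x y z b0 c0 y0; field; rewrite y0 b0 c0.
Qed.

(** Follows from r C(n, r) = (n-r+1) C(n, r-1). *)
Lemma dimdE : dimd R n r =
  'C(n, r)%:R * ((n - 2 * r).+1%:R / (n - r).+1%:R).
Proof.
rewrite /dimd; case: r hr hn => // k _ kn /=.
have E := mul_bin_left n k.
have -> : 'C(n, k)%:R = 'C(n, k.+1)%:R * k.+1%:R / (n - k)%:R :> R.
  rewrite -natrM mulnC E natrM mulrAC mulfV ?mul1r // pnatr_eq0; lia.
have -> : ((n - k.+1).+1 = n - k)%N by lia.
have -> : (n - 2 * k.+1).+1%:R = (n - k)%:R - k.+1%:R :> R.
  by rewrite -natrB; [congr _%:R; lia | lia].
have nk0 : (n - k)%:R != 0 :> R by rewrite pnatr_eq0; lia.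
by move: nk0; move: ((n - k)%:R) => x x0; field.
Qed.

Lemma dimd_gt0 : 0 < dimd R n r.
Proof.
rewrite dimdE mulr_gt0 ?divr_gt0 ?ltr0n // bin_gt0; exact: leq_double_l.
Qed.

Lemma top_coef_pairs (s : nat) : (s <= r)%N ->
  (-1) ^+ (r - s) * 'C(r, s)%:R * (npairs n r s)%:R^-1 =
  (dimd R n r)^-1 * top_coef s.
Proof.
move=> sr; have rn := leq_double_l hn.
have b0 : 'C(n, r)%:R != 0 :> R by rewrite pnatr_eq0 -lt0n bin_gt0.
have b1 : 'C(r, s)%:R != 0 :> R by rewrite pnatr_eq0 -lt0n bin_gt0.
have b2 : 'C(n - r, r - s)%:R != 0 :> R.
  by rewrite pnatr_eq0 -lt0n bin_gt0; lia.
have n0 : (n - r).+1%:R != 0 :> R by rewrite pnatr_eq0.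
have m0 : (n - 2 * r).+1%:R != 0 :> R by rewrite pnatr_eq0.
rewrite dimdE /npairs /top_coef !natrM.
move: b0 b1 b2 n0 m0.
move: ('C(n, r)%:R) ('C(r, s)%:R) ('C(n - r, r - s)%:R).
move: ((n - r).+1%:R) ((n - 2 * r).+1%:R).
by move=> x y a b c a0 b0 c0 x0 y0; field; rewrite a0 b0 c0 x0 y0.
Qed.

Lemma big_setU1 (T : finType) (K : {set T}) (F : {set T} -> R) :
  \sum_(I : {set T} | (#|I| == #|K|.+1) && (K \subset I)) F I =
  \sum_(x | x \notin K) F (x |: K).
Proof.
transitivity (\sum_(I in [set x |: K | x in ~: K]) F I).
  apply: eq_bigl => I; apply/andP/imsetP => [[cI KI]|[x xK ->]].
    have /cards1P[x xE] : #|I :\: K| == 1%N.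
      by rewrite cardsD (finset.setIidPr KI) (eqP cI) subSnn.
    have : x \in I :\: K by rewrite xE set11.
    rewrite inE => /andP[xK xI]; exists x; first by rewrite inE.
    by rewrite -xE finset.setDE finset.setUIl (finset.setUC (~: K))
      finset.setUCr finset.setIT; apply/esym/finset.setUidPl.
  by move: xK; rewrite inE => xK; rewrite cardsU1 xK eqxx finset.subsetUr.
rewrite big_imset /=; first by apply: eq_bigl => x; rewrite inE.
move=> x y; rewrite !inE => xK yK /finset.setP/(_ x).
by rewrite !inE eqxx (negbTE xK) /= orbF => /esym/eqP.
Qed.

Definition upper_sum (A : array R n r) (J : {set 'I_n}) : R :=
  \sum_(I : subsets n r | J \subset val I) A I.

(** Double counting: a given I containing J is reached once for each x in I outside J. *)
Lemma upper_sum_succ (A : array R n r) (J : {set 'I_n}) :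
  \sum_(x | x \notin J) upper_sum A (x |: J) =
  upper_sum A J *+ (r - #|J|).
Proof.
rewrite /upper_sum -sumrMnl.
rewrite (exchange_big_dep (fun I : subsets n r => J \subset val I)) //=.
  apply: eq_bigr => I JI; rewrite sumr_const; congr (_ *+ _).
  have -> : (r - #|J|)%N = #|val I :\: J|.
    by rewrite cardsD (finset.setIidPr JI) (eqP (valP I)).
  rewrite -!sum1_card; apply: eq_bigl => x.
  by rewrite unfold_in inE finset.subUset finset.sub1set JI andbT.
by move=> x I _ /(fintype.subset_trans (finset.subsetUr _ _)).
Qed.

(** A pair (I, J) contributes once for each [j]-set contained in both. *)
Lemma down_adj_down (j : nat) (A : array R n r) (I : subsets n r) :
  down_adj r (Defs.down j A) I =
  \sum_(J : subsets n r) 'C(#|val I :&: val J|, j)%:R * A J.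
Proof.
rewrite ffunE.
under eq_bigr => J _ do rewrite ffunE.
rewrite (exchange_big_dep xpredT) //=; apply: eq_bigr => J _.
rewrite sumr_const mulr_natl; congr (_ *+ _).
rewrite -cards_draws -!sum1_card.
rewrite (big_subsets _ j (fun L => (L \subset val I) && (L \subset val J))
  (fun=> 1%N)) /=.
by apply: eq_bigl => L; rewrite inE finset.subsetI andbC.
Qed.

Lemma UopE (A : array R n r) (I : subsets n r) :
  Uop A I = \sum_(J : subsets n r) top_coef #|val I :&: val J| * A J.
Proof.
rewrite ffunE.
under eq_bigr => j _ do rewrite down_adj_down big_distrr /=.
rewrite exchange_big /=; apply: eq_bigr => J _.
rewrite -top_coefE; last first.
  by rewrite -[leqRHS](eqP (valP I)) subset_leq_card ?finset.subsetIl.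
by rewrite big_distrl /=; apply: eq_bigr => j _; rewrite mulrA.
Qed.

(** Downward induction on |J|. For |J| = r-1 the sum vanishes column by column, by [top_coef_rec];
    for smaller J, [upper_sum_succ] writes a positive multiple of the sum at J through sums at
    larger sets. *)
Lemma upper_sum_Uop0 (A : array R n r) (J : {set 'I_n}) :
  (#|J| < r)%N -> upper_sum (Uop A) J = 0.
Proof.
have [k kE] : exists k, k = (r - #|J|)%N by exists (r - #|J|)%N.
elim: k J kE => [|[|k] IH] J kE Jr; first by lia.
  rewrite /upper_sum; under eq_bigr => I _ do rewrite UopE.
  rewrite exchange_big /= big1 // => L _.
  rewrite -big_distrl /= (big_subsets _ _ (fun I => J \subset I)
    (fun I => top_coef #|I :&: val L|)).
  have rJ : r = #|J|.+1 by lia.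
  under eq_bigl => I do rewrite [X in _ == X]rJ.
  rewrite big_setU1.
  have cL : #|val L| = r := eqP (valP L).
  have := cardsUI J (val L).
  set t := #|J :&: val L| => cU.
  have tr : (t < r)%N by rewrite rJ ltnS subset_leq_card ?finset.subsetIl.
  rewrite (bigID (mem (val L))) /=.
  rewrite (eq_bigr (fun=> top_coef t.+1)); last first.
    move=> x /andP[xJ xL]; congr top_coef.
    rewrite finset.setIUl (finset.setIidPl _) ?finset.sub1set //.
    rewrite cardsU1 inE (negbTE xJ) /=.
    by rewrite -add1n.
  rewrite [X in _ + X](eq_bigr (fun=> top_coef t)); last first.
    move=> x /andP[xJ xL]; congr top_coef.
    have -> : (x |: J) :&: val L = J :&: val L; last by [].
    apply/finset.setP => y; rewrite !inE; case: eqVneq => // ->.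
    by rewrite (negbTE xJ) (negbTE xL).
  rewrite !sumr_const.
  have -> : #|[pred x | x \notin J & x \in val L]| = (r - t)%N.
    have -> : (r - t)%N = #|val L :\: J|.
      by rewrite cardsD finset.setIC cL.
    by rewrite -!sum1_card; apply: eq_bigl => x; rewrite !inE.
  have -> : #|[pred x | x \notin J & x \notin val L]| = (n - 2 * r + 1 + t)%N.
    have -> : (n - 2 * r + 1 + t)%N = #|~: (J :|: val L)|.
      by rewrite cardsCs finset.setCK card_ord; lia.
    by rewrite -!sum1_card; apply: eq_bigl => x; rewrite !inE negb_or.
  by rewrite top_coef_rec ?mul0r.
have := upper_sum_succ (Uop A) J; rewrite big1; last first.
  by move=> x xJ; apply: IH; rewrite cardsU1 xJ; lia.
by move/esym/eqP; rewrite -kE mulrn_eq0 /= => /eqP.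
Qed.

(** Applied to U A, all terms with j < r vanish. The term j = r has coefficient 1 and is the
    identity, since C(|I n J|, r) = 0 for J <> I. *)
Lemma Uop_idem (A : array R n r) : Uop (Uop A) = Uop A.
Proof.
apply/ffunP => I; rewrite [LHS]ffunE big_ord_recr /= big1 ?add0r => [|j _];
  last first.
  rewrite ffunE big1 ?mulr0 // => J _; rewrite ffunE.
  by apply: (@upper_sum_Uop0 A (val J)); rewrite (eqP (valP J)).
rewrite subnn bin0 expr0 divr1 mul1r down_adj_down (bigD1 I) //= finset.setIid.
rewrite (eqP (valP I)) binn mul1r big1 ?addr0 // => J JI.
have -> : 'C(#|val I :&: val J|, r) = 0%N; last by rewrite mul0r.
apply: bin_small; rewrite ltnNge -{1}(eqP (valP I)); apply: contra JI => le.
have /eqP E : val I :&: val J == val I by rewrite eqEcard finset.subsetIl.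
rewrite eq_sym -val_eqE eqEcard (eqP (valP I)) (eqP (valP J)) leqnn andbT.
exact/finset.setIidPl.
Qed.

(** U is idempotent, and symmetric because its entries depend on |I n J| only; hence |U A|^2 = <U A,
    A>, and sorting this double sum by overlap gives d times [Tdir]. *)
Theorem Tdir_projection (A : array R n r) :
  Tdir A = (dimd R n r)^-1 * sqnorm (Uop A).
Proof.
have -> : sqnorm (Uop A) = \sum_I Uop A I * A I.
  rewrite /sqnorm /dot.
  under eq_bigr => I _ do rewrite [in X in X * _]UopE big_distrl /=.
  rewrite exchange_big /=; apply: eq_bigr => J _.
  rewrite -[in RHS]Uop_idem UopE big_distrl /=; apply: eq_bigr => I _.
  by rewrite finset.setIC; ring.
rewrite /Tdir big_distrr /=.
under eq_bigr => s _ do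
  rewrite (top_coef_pairs (ltn_ord s : (s <= r)%N)) big_distrr /=.
rewrite exchange_big /=; apply: eq_bigr => I _.
rewrite UopE big_distrl big_distrr /=.
under eq_bigr => s _ do rewrite big_distrr /= big_mkcond /=.
rewrite exchange_big /=; apply: eq_bigr => J _.
have sr : (#|val I :&: val J| < r.+1)%N.
  by rewrite ltnS -[leqRHS](eqP (valP I)) subset_leq_card ?finset.subsetIl.
rewrite (bigD1 (Ordinal sr)) //= eqxx big1 ?addr0; first by ring.
by move=> s; rewrite -val_eqE /= eq_sym => /negbTE->.
Qed.

Lemma Tdir_ge0 (A : array R n r) : 0 <= Tdir A.
Proof.
rewrite Tdir_projection mulr_ge0 ?invr_ge0 ?(ltW dimd_gt0) //.
by apply: sumr_ge0 => I _; rewrite -expr2 sqr_ge0.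
Qed.

End Johnson.

(** * Families of independent variables with a common law *)

Section IidFamily.
Context {R : realType} {dS : measure_display} {S : measurableType dS}.
Variable mu : probability S R.
Local Open Scope classical_set_scope.
Local Open Scope ring_scope.
Local Open Scope ereal_scope.

(** One product formula over the whole finite index set suffices, since any [B k] may be the full
    space. Keeping [P] a bare set function also accommodates product measures. *)
Definition iid_family (d : measure_display) (T : measurableType d)
    (P : set T -> \bar R) (K : finType) (X : K -> T -> S) : Prop :=
  (forall k, measurable_fun [set: T] (X k)) /\
  forall B : K -> set S, (forall k, measurable (B k)) ->
    P [set w | forall k, B k (X k w)] = \prod_k mu (B k).

Definition sum_family (T1 T2 : Type) (K1 K2 : finType) (X : K1 -> T1 -> S)
    (Y : K2 -> T2 -> S) (k : K1 + K2) (w : T1 * T2) : S :=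
  match k with inl a => X a w.1 | inr b => Y b w.2 end.

Lemma measurable_preimage_all (d : measure_display) (T : measurableType d)
    (K : finType) (X : K -> T -> S) (B : K -> set S) :
  (forall k, measurable_fun [set: T] (X k)) -> (forall k, measurable (B k)) ->
  measurable [set w | forall k, B k (X k w)].
Proof.
move=> mX mB.
have -> : [set w | forall k, B k (X k w)] = \bigcap_(k in [set: K]) X k @^-1` B k.
  by apply/seteqP; split=> w /= h k; [move=> _; exact: h|exact: (h k I)].
apply: fin_bigcap_measurable => // k _.
by rewrite -[X in measurable X]setTI; exact: mX.
Qed.

(** An event with one condition per variable is a rectangle in T1 x T2, on which the product measure
    multiplies. *)
Lemma iid_sum_family (d1 d2 : measure_display) (T1 : measurableType d1)
    (T2 : measurableType d2) (P1 : {measure set T1 -> \bar R})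
    (P2 : {sigma_finite_measure set T2 -> \bar R}) (K1 K2 : finType)
    (X : K1 -> T1 -> S) (Y : K2 -> T2 -> S) :
  iid_family P1 X -> iid_family P2 Y ->
  iid_family (P1 \x P2) (sum_family X Y).
Proof.
move=> [mX iX] [mY iY]; split.
  by case=> k; [exact: (measurableT_comp (mX k))|exact: (measurableT_comp (mY k))].
move=> B mB.
have -> : [set w | forall k, B k (sum_family X Y k w)] =
    [set w | forall k, B (inl k) (X k w)] `*`
    [set w | forall k, B (inr k) (Y k w)].
  apply/seteqP; split=> -[w1 w2] /=.
    by move=> h; split=> k; [exact: (h (inl k))|exact: (h (inr k))].
  by move=> [h1 h2] [k|k] /=; [exact: h1|exact: h2].
rewrite product_measure1E; last 2 first.
- exact: (@measurable_preimage_all _ _ _ X (B \o inl) mX (fun k => mB (inl k))).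
- exact: (@measurable_preimage_all _ _ _ Y (B \o inr) mY (fun k => mB (inr k))).
rewrite big_sumType; congr (_ * _).
  exact: (iX (B \o inl) (fun k => mB (inl k))).
exact: (iY (B \o inr) (fun k => mB (inr k))).
Qed.

(** [u] may repeat an index, so that two overlapping argument lists can be read as one list. *)
Definition tuple_map (T : Type) (K : finType) (X : K -> T -> S) (m : nat)
  (u : 'I_m -> K) (w : T) : m.-tuple S := [tuple X (u a) w | a < m].

Lemma measurable_tuple_map (d : measure_display) (T : measurableType d)
    (K : finType) (X : K -> T -> S) (m : nat) (u : 'I_m -> K) :
  (forall k, measurable_fun [set: T] (X k)) ->
  measurable_fun [set: T] (tuple_map X u).
Proof.
move=> mX; apply/measurable_fun_tnthP => i.
by apply: eq_measurable_fun (mX (u i)) => w _ /=; rewrite tnth_mktuple.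
Qed.

Definition rectangles (m : nat) : set (set (m.-tuple S)) :=
  [set A | exists2 B : 'I_m -> set S, forall a, measurable (B a) &
     A = [set t | forall a, B a (tnth t a)]].

Lemma measurable_rectangles (m : nat) :
  @measurable _ (m.-tuple S) = <<s @rectangles m >>.
Proof.
apply/seteqP; split.
  apply: smallest_sub; first exact: smallest_sigma_algebra.
  move=> A; rewrite -bigcup_seq /= => -[i _ [B mB <-]].
  apply: sub_sigma_algebra.
  (* A cylinder is a rectangle with the full space at every other coordinate. *)
  exists (fun j => if j == i then B else setT); first by move=> j; case: ifP.
  rewrite setTI; apply/seteqP; split=> t /=.
    by move=> h j; case: eqVneq => // ->.
  by move=> /(_ i); rewrite eqxx.
apply: smallest_sub; first exact: sigma_algebra_measurable.
move=> _ [B mB ->].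
exact: (@measurable_preimage_all _ _ _ (fun a (t : m.-tuple S) => tnth t a) B
  (fun a => measurable_tnth a) mB).
Qed.

(* Here a ranges over the least elements of the classes of ker u, so the
   right-hand side depends on u only through ker u. *)
Lemma iid_rectangle (d : measure_display) (T : measurableType d)
    (P : set T -> \bar R) (K : finType) (X : K -> T -> S) (m : nat)
    (u : 'I_m -> K) (B : 'I_m -> set S) :
  iid_family P X -> (forall a, measurable (B a)) ->
  P [set w | forall a, B a (X (u a) w)] =
  \prod_(a | [forall b : 'I_m, (u b == u a) ==> (a <= b)%N])
     mu [set s | forall b, u b == u a -> B b s].
Proof.
move=> [_ iX] mB.
have mC k : measurable [set s | forall b, u b == k -> B b s].
  have -> : [set s | forall b, u b == k -> B b s] =
      \bigcap_(b in [set b | u b == k]) B b.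
    by apply/seteqP; split.
  exact: fin_bigcap_measurable.
(* Conditions bearing on the same variable are merged, after which independence applies. *)
have -> : [set w | forall a, B a (X (u a) w)] =
    [set w | forall k, [set s | forall b, u b == k -> B b s] (X k w)].
  apply/seteqP; split=> w /=.
    by move=> h k b /eqP<-; exact: h.
  by move=> h a; apply: (h (u a)).
rewrite (iX (fun k => [set s | forall b, u b == k -> B b s])) //.
pose A := [set a | [forall b : 'I_m, (u b == u a) ==> (a <= b)%N]]%SET.
(* Variables outside the image of [u] carry no condition and contribute the factor 1. *)
rewrite (bigID (mem (u @: A)))/= [X in _ * X]big1 ?mule1; last first.
  move=> k kA.
  have -> : [set s | forall b, u b == k -> B b s] = setT.
    apply/seteqP; split=> // s _ b /eqP ub.
    exfalso; move/negP: kA; apply.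
    have ub0 : u b == k by rewrite ub.
    case: (@arg_minnP _ b (fun b => u b == k) (@nat_of_ord m) ub0).
    move=> a /eqP ua amin; apply/imsetP; exists a => //.
    by rewrite inE; apply/forallP => c; apply/implyP; rewrite ua; exact: amin.
  exact: probability_setT.
rewrite big_imset /=; first by apply: eq_bigl => a; rewrite inE.
move=> a b; rewrite !inE => /forallP/(_ b) + /forallP/(_ a) + uab.
rewrite uab eqxx /= => ab ba; apply/val_inj/eqP.
by rewrite /= eqn_leq ab ba.
Qed.

(** Rectangles are a generating pi-system, and by [iid_rectangle] the two laws agree on them, since
    only the coincidences among the indices enter the formula. *)
Lemma iid_tuple_law (d1 d2 : measure_display) (T1 : measurableType d1)
    (T2 : measurableType d2) (P1 : probability T1 R)
    (P2 : probability T2 R) (K1 K2 : finType)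
    (X : K1 -> T1 -> S) (Y : K2 -> T2 -> S) (m : nat)
    (u : 'I_m -> K1) (v : 'I_m -> K2) (A : set (m.-tuple S)) :
  iid_family P1 X -> iid_family P2 Y ->
  (forall a b, (u a == u b) = (v a == v b)) ->
  measurable A ->
  pushforward P1 (tuple_map X u) A = pushforward P2 (tuple_map Y v) A.
Proof.
move=> iX iY uv mA.
have mX := measurable_tuple_map u iX.1.
have mY := measurable_tuple_map v iY.1.
pose X' := mfun_Sub (mem_set mX); pose Y' := mfun_Sub (mem_set mY).
apply: (@measure_unique _ R _ (@rectangles m) (fun=> setT) _ _ _ _
  (distribution P1 X') (distribution P2 Y')) => //.
- exact: measurable_rectangles.
- move=> _ _ [B mB ->] [C mC ->]; exists (fun a => B a `&` C a).
    by move=> a; exact: measurableI.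
  apply/seteqP; split=> t /=; first by move=> [h1 h2] a; split.
  by move=> h; split=> a; have [] := h a.
- move=> _; exists (fun=> setT) => //; by apply/seteqP; split.
- by rewrite bigcup_const //; exists 0%N.
- move=> _ [B mB ->].
  change (P1 (tuple_map X u @^-1` [set t | forall a, B a (tnth t a)]) =
          P2 (tuple_map Y v @^-1` [set t | forall a, B a (tnth t a)])).
  have -> : tuple_map X u @^-1` [set t | forall a, B a (tnth t a)] =
      [set w | forall a, B a (X (u a) w)].
    by apply/seteqP; split=> w /= h a; move: (h a); rewrite tnth_mktuple.
  have -> : tuple_map Y v @^-1` [set t | forall a, B a (tnth t a)] =
      [set w | forall a, B a (Y (v a) w)].
    by apply/seteqP; split=> w /= h a; move: (h a); rewrite tnth_mktuple.
  rewrite (iid_rectangle _ iX) // (iid_rectangle _ iY) //.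
  apply: eq_big => [a|a _]; first by apply: eq_forallb => b; rewrite uv.
  by congr (mu _); apply/seteqP; split=> s /= h b; [rewrite -uv|rewrite uv]; exact: h.
- move=> _; apply: (@le_lt_trans _ _ 1); last exact: ltry.
  exact: (probability_le1 (distribution P1 X') measurableT).
Qed.

(** Both integrals are integrals of [f] against the law of the tuple; integrability transfers in the
    same way, through |f|. *)
Lemma eq_iid_integrable (d1 d2 : measure_display) (T1 : measurableType d1)
    (T2 : measurableType d2) (P1 : probability T1 R)
    (P2 : probability T2 R) (K1 K2 : finType)
    (X : K1 -> T1 -> S) (Y : K2 -> T2 -> S) (m : nat)
    (u : 'I_m -> K1) (v : 'I_m -> K2) (f : m.-tuple S -> \bar R) :
  iid_family P1 X -> iid_family P2 Y ->
  (forall a b, (u a == u b) = (v a == v b)) ->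
  measurable_fun [set: m.-tuple S] f ->
  P1.-integrable setT (fun w => f (tuple_map X u w)) ->
  P2.-integrable setT (fun w => f (tuple_map Y v w)) /\
  \int[P2]_w f (tuple_map Y v w) = \int[P1]_w f (tuple_map X u w).
Proof.
move=> iX iY uv mf /[dup] fX /integrableP[_ fXoo].
have mX := measurable_tuple_map u iX.1.
have mY := measurable_tuple_map v iY.1.
pose X' := mfun_Sub (mem_set mX); pose Y' := mfun_Sub (mem_set mY).
have law A : measurable A -> A `<=` setT ->
    distribution P1 X' A = distribution P2 Y' A.
  by move=> mA _; exact: (iid_tuple_law iX iY uv mA).
have fY : P2.-integrable setT (fun w => f (tuple_map Y v w)).
  apply/integrableP; split; first exact: measurableT_comp.
  rewrite -(@ge0_integral_distribution _ _ _ _ _ P2 Y' (abse \o f)) //=; last first.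
    exact: measurableT_comp.
  rewrite -(eq_measure_integral _ law).
  rewrite (@ge0_integral_distribution _ _ _ _ _ P1 X' (abse \o f)) //=.
  exact: measurableT_comp.
split=> //.
transitivity (\int[distribution P2 Y']_y f y); first
  by rewrite integral_distribution.
rewrite -(eq_measure_integral _ law).
exact: (@integral_distribution _ _ _ _ _ P1 X' f).
Qed.

End IidFamily.

(** * Pairs of argument lists up to reordering *)

Definition overlap (K : finType) (r : nat) (u v : 'I_r -> K) : nat :=
  #|(u @: [set: 'I_r]) :&: (v @: [set: 'I_r])|%SET.

Lemma image_permutation (K : finType) (r : nat) (u : 'I_r -> K) (s : seq K) :
  injective u -> perm_eq s (enum (u @: [set: 'I_r])%SET) ->
  exists p : 'S_r, s = [seq u (p i) | i <- enum 'I_r].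
Proof.
move=> uI su.
have : perm_eq s [tuple u i | i < r].
  apply: (perm_trans su); apply: uniq_perm; first exact: enum_uniq.
    by rewrite map_inj_uniq ?enum_uniq.
  move=> x; rewrite mem_enum; apply/imsetP/mapP => -[i _ ->]; exists i => //.
  by rewrite mem_enum.
move/tuple_permP => [p ->]; exists p; apply: eq_map => i /=.
by rewrite tnth_mktuple.
Qed.

(** Both images are enumerated with their common values first and in the same order; beyond that
    block, values of [u] lie outside the image of [v]. *)
Lemma overlap_normal_form (K : finType) (r : nat) (u v : 'I_r -> K) :
  injective u -> injective v ->
  exists s t : 'S_r, forall i j,
    (u (s i) == v (t j)) = (i == j) && (i < overlap u v)%N.
Proof.
move=> uI vI.
set U := (u @: [set: 'I_r])%SET; set V := (v @: [set: 'I_r])%SET.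
have split_enum (A B : {set K}) :
    perm_eq (enum (A :&: B)%SET ++ enum (A :\: B)%SET) (enum A).
  apply: uniq_perm; rewrite ?enum_uniq //.
    rewrite cat_uniq !enum_uniq /= andbT; apply/hasPn => x.
    by rewrite !mem_enum !inE => /andP[/negbTE->]; rewrite andbF.
  by move=> x; rewrite mem_cat !mem_enum !inE; case: (x \in A); case: (x \in B).
have [s sE] := image_permutation uI (split_enum U V).
have [t] := image_permutation vI (split_enum V U).
rewrite finset.setIC => tE; exists s, t => i j.
set C := enum (U :&: V)%SET in sE tE.
have nu x0 k : nth x0 (C ++ enum (U :\: V)%SET) (nat_of_ord k) = u (s k).
  by rewrite sE (nth_map k) ?size_enum_ord // nth_ord_enum.
have nv x0 k : nth x0 (C ++ enum (V :\: U)%SET) (nat_of_ord k) = v (t k).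
  by rewrite tE (nth_map k) ?size_enum_ord // nth_ord_enum.
have sv : uniq (C ++ enum (V :\: U)%SET) /\ size (C ++ enum (V :\: U)%SET) = r.
  rewrite tE size_map size_enum_ord map_inj_uniq ?enum_uniq //.
  by move=> a b /vI /perm_inj.
have -> : overlap u v = size C by rewrite -cardE.
have x0 := u i.
have [iC|iC] := ltnP i (size C).
  rewrite andbT -(nu x0) -(nv x0) nth_cat iC.
  have -> : nth x0 C i = nth x0 (C ++ enum (V :\: U)%SET) i by rewrite nth_cat iC.
  by rewrite nth_uniq ?sv.1 // sv.2.
rewrite andbF; apply/negbTE/eqP => E.
have : u (s i) \in enum (U :\: V)%SET.
  rewrite -(nu x0) nth_cat ltnNge iC /= mem_nth //.
  by rewrite -(ltn_add2l (size C)) subnKC // -size_cat sE size_map size_enum_ord.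
by rewrite mem_enum inE E /V imset_f ?inE.
Qed.

Section KernelProduct.
Context {R : realType} {dS : measure_display} {S : measurableType dS}.
Variable mu : probability S R.
Local Open Scope classical_set_scope.
Local Open Scope ring_scope.

Lemma symmetric_tuple_map (T : Type) (K : finType) (X : K -> T -> S) (r : nat)
    (h : r.-tuple S -> R) (u : 'I_r -> K) (s : 'S_r) (w : T) :
  symmetric_kernel h -> h (tuple_map X (u \o s) w) = h (tuple_map X u w).
Proof.
move=> hs; rewrite -(hs s (tuple_map X u w)); congr h.
by apply: eq_from_tnth => i; rewrite !tnth_mktuple.
Qed.

(** Symmetry of the kernels lets both pairs be put in normal form. Concatenating each pair into one
    index map of length r + r then gives coincidences that depend on the overlap alone. *)
Lemma eq_iid_kernel_product (d1 d2 : measure_display) (T1 : measurableType d1)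
    (T2 : measurableType d2) (P1 : probability T1 R)
    (P2 : probability T2 R) (K1 K2 : finType)
    (X : K1 -> T1 -> S) (Y : K2 -> T2 -> S) (r : nat) (h1 h2 : r.-tuple S -> R)
    (u u' : 'I_r -> K1) (v v' : 'I_r -> K2) :
  iid_family mu P1 X -> iid_family mu P2 Y ->
  measurable_fun [set: r.-tuple S] h1 -> measurable_fun [set: r.-tuple S] h2 ->
  symmetric_kernel h1 -> symmetric_kernel h2 ->
  injective u -> injective u' -> injective v -> injective v' ->
  overlap u u' = overlap v v' ->
  P1.-integrable setT
    (fun w => (h1 (tuple_map X u w) * h2 (tuple_map X u' w))%:E) ->
  P2.-integrable setT
    (fun w => (h1 (tuple_map Y v w) * h2 (tuple_map Y v' w))%:E) /\
  (\int[P2]_w (h1 (tuple_map Y v w) * h2 (tuple_map Y v' w))%:E =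
   \int[P1]_w (h1 (tuple_map X u w) * h2 (tuple_map X u' w))%:E)%E.
Proof.
move=> iX iY mh1 mh2 sh1 sh2 uI u'I vI v'I uv.
have [s [s' sE]] := overlap_normal_form uI u'I.
have [t [t' tE]] := overlap_normal_form vI v'I.
pose cat (K : finType) (f g : 'I_r -> K) (a : 'I_(r + r)) :=
  match fintype.split a with inl i => f i | inr j => g j end.
pose L (z : (r + r).-tuple S) := [tuple tnth z (lshift r i) | i < r].
pose L' (z : (r + r).-tuple S) := [tuple tnth z (rshift r i) | i < r].
pose f (z : (r + r).-tuple S) := (h1 (L z) * h2 (L' z))%:E.
have fE T (K : finType) (Z : K -> T -> S) (a b : 'I_r -> K) (p q : 'S_r) :
    (fun w => f (tuple_map Z (cat K (a \o p) (b \o q)) w)) =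
    (fun w => (h1 (tuple_map Z a w) * h2 (tuple_map Z b w))%:E).
  apply: funext => w; rewrite /f.
  rewrite -(symmetric_tuple_map Z a p w sh1) -(symmetric_tuple_map Z b q w sh2).
  congr (h1 _ * h2 _)%:E; apply: eq_from_tnth => i; rewrite !tnth_mktuple /cat.
    by rewrite -[lshift _ _]/(fintype.unsplit (inl i)) unsplitK.
  by rewrite -[rshift _ _]/(fintype.unsplit (inr i)) unsplitK.
have mf : measurable_fun [set: (r + r).-tuple S] f.
  apply/measurable_EFinP; apply: measurable_funM.
    apply: (measurableT_comp mh1); apply/measurable_fun_tnthP => i.
    by apply: eq_measurable_fun (measurable_tnth (lshift r i)) => z _ /=;
      rewrite tnth_mktuple.
  apply: (measurableT_comp mh2); apply/measurable_fun_tnthP => i.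
  by apply: eq_measurable_fun (measurable_tnth (rshift r i)) => z _ /=;
    rewrite tnth_mktuple.
have ker a b : (cat K1 (u \o s) (u' \o s') a == cat K1 (u \o s) (u' \o s') b) =
    (cat K2 (v \o t) (v' \o t') a == cat K2 (v \o t) (v' \o t') b).
  rewrite /cat; case: (fintype.split a) => i; case: (fintype.split b) => j /=.
  - by rewrite !(inj_eq uI, inj_eq vI, inj_eq perm_inj).
  - by rewrite sE tE uv.
  - by rewrite eq_sym sE eq_sym [in RHS]eq_sym tE uv eq_sym.
  - by rewrite !(inj_eq u'I, inj_eq v'I, inj_eq perm_inj).
have := eq_iid_integrable iX iY ker mf.
have E1 := fE _ _ X u u' s s'; have E2 := fE _ _ Y v v' t t'.
rewrite E1 E2 => H H1; have [H2 H3] := H H1; split=> //; exact: H3.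
Qed.

End KernelProduct.

(** * Fubini for products of projections *)

(** The ascribed type equips the product with its [probability] structure, so that it can itself
    serve as a factor. *)
Definition product_probability (R : realType) (d1 d2 : measure_display)
  (T1 : measurableType d1) (T2 : measurableType d2)
  (P1 : probability T1 R) (P2 : probability T2 R) :
  probability (T1 * T2)%type R := (P1 \x P2)%E.

Section Decoupling.
Context {R : realType} {d1 d2 : measure_display}
  {T1 : measurableType d1} {T2 : measurableType d2}.
Variables (P1 : probability T1 R) (P2 : probability T2 R).
Local Open Scope classical_set_scope.
Local Open Scope ring_scope.

(** For fixed x the two factors depend on independent coordinates, so the inner integral splits into
    the product of the two [g]; Fubini then gives the equality. *)
Lemma integral_decoupling (F1 F2 : T1 * T2 -> R) :
  (P1 \x P2)%E.-integrable setT (EFin \o F1) ->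
  (P1 \x P2)%E.-integrable setT (EFin \o F2) ->
  (P1 \x product_probability P2 P2)%E.-integrable setT
    (fun z => (F1 (z.1, z.2.1) * F2 (z.1, z.2.2))%:E) ->
  let g F x := fine (\int[P2]_y (F (x, y))%:E)%E in
  P1.-integrable setT (fun x => (g F1 x * g F2 x)%:E) /\
  (\int[P1]_x (g F1 x * g F2 x)%:E =
   \int[P1 \x product_probability P2 P2]_z (F1 (z.1, z.2.1) * F2 (z.1, z.2.2))%:E)%E.
Proof.
move=> iF1 iF2 iF12 g.
have mg F : (P1 \x P2)%E.-integrable setT (EFin \o F) ->
    measurable_fun setT (g F).
  by move=> iF; apply: (measurableT_comp (fine_measurable measurableT)) => //;
    exact: (measurable_fubini_F iF).
have mg12 : measurable_fun setT (fun x => (g F1 x * g F2 x)%:E).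
  by apply/measurable_EFinP; apply: measurable_funM; exact: mg.
have ae1 := ae_integrable1 iF1; have ae2 := ae_integrable1 iF2.
have ae12 := ae_integrable1 iF12.
have mG := measurable_fubini_F iF12.
(* The splitting uses integrability of three slices at [x], which holds for almost every [x]; there
   [fine] loses nothing. *)
have E : ae_eq P1 setT (fubini_F (product_probability P2 P2)
    (fun z => (F1 (z.1, z.2.1) * F2 (z.1, z.2.2))%:E))
    (fun x => (g F1 x * g F2 x)%:E).
  move: ae1 ae2 ae12; apply: filterS3 => x i1 i2 i12 _.
  rewrite /fubini_F -[LHS](integral12_prod_meas1 (m1 := P2) (m2 := P2) i12).
  rewrite /fubini_F /=.
  have E2 : (\int[P2]_y (F2 (x, y))%:E = (g F2 x)%:E)%E.
    by rewrite fineK //; exact: (integrable_fin_num measurableT i2).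
  transitivity (\int[P2]_y ((F1 (x, y))%:E * (g F2 x)%:E))%E.
    apply: eq_integral => y _; rewrite -E2 -integralZl //.
  rewrite integralZr // EFinM; congr (_ * _)%E.
  by rewrite fineK //; exact: (integrable_fin_num measurableT i1).
have iF := integrable_fubini_F iF12.
have Eint : (\int[P1]_x (g F1 x * g F2 x)%:E =
   \int[P1 \x product_probability P2 P2]_z (F1 (z.1, z.2.1) * F2 (z.1, z.2.2))%:E)%E.
  rewrite -(integral12_prod_meas1 iF12); apply/esym; exact: ae_eq_integral.
split=> //; apply/integrableP; split=> //.
move/integrableP: iF => [_]; congr (_ < _)%E.
apply: ae_eq_integral => //; [exact: measurableT_comp|exact: measurableT_comp|].
by move: E; apply: filterS => x Ex /Ex /= ->.
Qed.

End Decoupling.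

(** * Alternating sums over subsets *)

Section Moebius.
Variable R : pzRingType.
Local Open Scope ring_scope.

(** For a point x outside A, the sets B and B + x have the same intersection with A and opposite
    signs. *)
Lemma alternating_sum_setI (T : finType) (A : {set T}) (phi : {set T} -> R) :
  A != [set: T]%SET -> \sum_(B : {set T}) (-1) ^+ #|B| * phi (A :&: B)%SET = 0.
Proof.
rewrite -finset.subTset => /subsetPn[x _ xA].
rewrite (bigID (fun B : {set T} => x \in B)) /= addrC.
rewrite [X in _ + X](reindex_onto (fun B => x |: B)%SET (fun B => B :\ x)%SET)
  /=; last first.
  by move=> B xB; rewrite finset.setD1K.
rewrite [X in _ + X](eq_bigl (fun B : {set T} => x \notin B)); last first.
  move=> B; rewrite finset.setU11 /=; apply/eqP/idP => [<-|xB].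
    by rewrite finset.setD11.
  by rewrite finset.setU1K.
rewrite -big_split /= big1 // => B xB.
have -> : (A :&: (x |: B) = A :&: B)%SET.
  apply/finset.setP => y; rewrite !inE; case: eqVneq => // ->.
  by rewrite (negbTE xA).
by rewrite cardsU1 xB add1n exprS mulN1r mulNr subrr.
Qed.

Lemma sign_setC (r : nat) (B : {set 'I_r}) :
  (-1) ^+ (r - #|B|) = (-1) ^+ #|~: B|%SET :> R.
Proof. by rewrite [in RHS]cardsCs finset.setCK card_ord. Qed.

(** After exchanging sums, the coefficient of [H C] is a signed count of the sets containing C,
    which vanishes unless C is the full set. *)
Lemma moebius_subsets (r : nat) (H G : {set 'I_r} -> R) :
  (forall A : {set 'I_r}, \sum_(C : {set 'I_r} | C \subset A) H C = G A) ->
  H [set: 'I_r]%SET = \sum_(B : {set 'I_r}) (-1) ^+ (r - #|B|) * G B.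
Proof.
move=> HG.
under eq_bigr => B _ do rewrite -HG big_distrr /=.
rewrite (exchange_big_dep xpredT) //=.
under eq_bigr => C _ do rewrite -big_distrl /=.
(* Complementing B turns containment of C into disjointness from C, a function of the intersection
   as [alternating_sum_setI] requires. *)
have sumE (C : {set 'I_r}) :
    \sum_(B : {set 'I_r} | C \subset B) (-1) ^+ (r - #|B|) =
    \sum_(B : {set 'I_r}) (-1) ^+ #|B| *
      (if (C :&: B == finset.set0)%SET then 1 else 0) :> R.
  rewrite (reindex_inj (can_inj (@finset.setCK _))) /= big_mkcond /=.
  apply: eq_bigr => B _; rewrite sign_setC finset.setCK.
  rewrite -finset.disjoints_subset -setI_eq0.
  by case: ifP; rewrite ?mulr1 ?mulr0.
rewrite (bigD1 [set: 'I_r]%SET) //= [X in _ + X]big1 ?addr0; last first.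
  move=> C CT; rewrite sumE.
  by rewrite (alternating_sum_setI
    (fun X => if X == finset.set0 then 1 else 0)) // mul0r.
rewrite (eq_bigl (pred1 [set: 'I_r]%SET)); last by move=> B; rewrite /= finset.subTset.
by rewrite big_pred1_eq cardsT card_ord subnn expr0 mul1r.
Qed.

(** Only A = [r] survives, where the overlap is |B|; the sets B are then grouped by size. *)
Lemma alternating_sum_overlap (r : nat) (theta : nat -> R) :
  \sum_(A : {set 'I_r}) \sum_(B : {set 'I_r})
    (-1) ^+ (r - #|A|) * ((-1) ^+ (r - #|B|) * theta #|A :&: B|%SET) =
  \sum_(s < r.+1) (-1) ^+ (r - s) * 'C(r, s)%:R * theta s.
Proof.
have signE (B : {set 'I_r}) : (-1) ^+ (r - #|B|) = (-1) ^+ r * (-1) ^+ #|B| :> R.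
  rewrite -signr_odd oddB; last by rewrite -[leqRHS]card_ord max_card.
  by rewrite signr_addb !signr_odd.
rewrite (bigD1 [set: 'I_r]%SET) //= [X in _ + X]big1 ?addr0; last first.
  move=> A AT; rewrite -big_distrr /=.
  under eq_bigr => B _ do rewrite signE -mulrA.
  by rewrite -big_distrr /= (alternating_sum_setI (fun X => theta #|X|)) // !mulr0.
rewrite cardsT card_ord subnn expr0.
under eq_bigr => B _ do rewrite mul1r finset.setTI.
rewrite (partition_big (fun B : {set 'I_r} => inord #|B| : 'I_r.+1) xpredT) //=.
apply: eq_bigr => s _.
rewrite (eq_bigr (fun=> (-1) ^+ (r - s) * theta s)); last first.
  move=> B /eqP <-; rewrite inordK // ltnS -[leqRHS]card_ord; exact: max_card.
rewrite sumr_const -mulrnAl -mulr_natr; congr (_ * _%:R * _).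
have -> : 'C(r, s) = 'C(#|'I_r|, s) by rewrite card_ord.
rewrite -card_draws -!sum1_card; apply: eq_bigl => B.
rewrite unfold_in !inE /= inordK //.
by rewrite ltnS -[leqRHS]card_ord; exact: max_card.
Qed.

End Moebius.

(** * Counting pairs with a given overlap *)

(** J corresponds to its part inside I, of size s, and its part outside I, of size r - s, chosen
    freely. *)
Lemma card_overlap (T : finType) (I : {set T}) (r s : nat) : (s <= r)%N ->
  #|[set J : {set T} | (#|J| == r) && (#|I :&: J| == s)%SET]| =
  ('C(#|I|, s) * 'C(#|T| - #|I|, r - s))%N.
Proof.
move=> sr.
pose P := [set X : {set T} | (X \subset I) && (#|X| == s)]%SET.
pose Q := [set Y : {set T} | (Y \subset ~: I) && (#|Y| == r - s)%N]%SET.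
have cT : #|~: I|%SET = (#|T| - #|I|)%N by rewrite cardsCs finset.setCK.
rewrite -cT -!cards_draws -/P -/Q -cardsX.
have meet X Y : X \in P -> Y \in Q ->
    ((X :|: Y) :&: I = X)%SET /\ ((X :|: Y) :&: ~: I = Y)%SET.
  rewrite !inE => /andP[XI _] /andP[YI _]; rewrite !finset.setIUl.
  rewrite (finset.setIidPl XI) (finset.setIidPl YI); split.
    by rewrite (_ : Y :&: I = finset.set0)%SET ?finset.setU0 //;
      apply/eqP; rewrite setI_eq0 finset.disjoints_subset.
  by rewrite (_ : X :&: ~: I = finset.set0)%SET ?finset.set0U //;
    apply/eqP; rewrite setI_eq0 finset.disjoints_subset finset.setCK.
have inj : {in finset.setX P Q &, injective (fun p => p.1 :|: p.2)%SET}.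
  move=> [X Y] [X' Y']; rewrite !finset.in_setX /= => /andP[XP YQ] /andP[XP' YQ'] E.
  have [e1 e2] := meet _ _ XP YQ; have [e1' e2'] := meet _ _ XP' YQ'.
  by move: e1 e2; rewrite [(X :|: Y)%SET]E /= e1' e2' => -> ->.
rewrite -(card_in_imset inj); apply: eq_card => J; rewrite inE.
apply/andP/imsetP => [[/eqP Jr /eqP Js]|[[X Y]]].
  exists (J :&: I, J :&: ~: I)%SET; last first.
    by rewrite /= -finset.setIUr finset.setUCr finset.setIT.
  rewrite finset.in_setX !inE !finset.subsetIr /= finset.setIC Js eqxx /=.
  by rewrite -finset.setDE cardsD finset.setIC Js Jr.
rewrite finset.in_setX /= => /andP[XP YQ] ->; have [e1 e2] := meet _ _ XP YQ.
rewrite finset.setIC e1; move: (XP) (YQ); rewrite !inE.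
move=> /andP[XI /eqP cX] /andP[YI /eqP cY].
split; last by rewrite cX.
rewrite cardsU (_ : X :&: Y = finset.set0)%SET ?cards0 ?cX ?cY; first by lia.
apply/eqP; rewrite setI_eq0 finset.disjoints_subset.
by apply: (fintype.subset_trans XI); rewrite -finset.setCS finset.setCK.
Qed.

Lemma sum_overlap_const (R : pzSemiRingType) (n r s : nat) (c : R) :
  (s <= r)%N ->
  (\sum_(I : subsets n r) \sum_(J : subsets n r | #|val I :&: val J|%SET == s) c =
   c *+ npairs n r s)%R.
Proof.
move=> sr.
have count (I : subsets n r) :
    (#|[pred J : subsets n r | #|val I :&: val J|%SET == s]| =
     'C(r, s) * 'C(n - r, r - s))%N.
  rewrite -sum1_card.
  rewrite (big_subsets _ r (fun J => #|val I :&: J|%SET == s) (fun=> 1%N)).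
  have := card_overlap (val I) sr; rewrite (eqP (valP I)) card_ord => <-.
  by rewrite -sum1_card; apply: eq_bigl => J; rewrite inE.
under eq_bigr => I _ do rewrite sumr_const count.
rewrite sumr_const -mulrnA; congr (_ *+ _)%R.
rewrite /npairs mulnC -mulnA; congr (_ * _)%N.
rewrite -sum1_card (big_subsets _ r xpredT (fun=> 1%N)).
have -> : 'C(n, r) = 'C(#|'I_n|, r) by rewrite card_ord.
rewrite -card_draws -sum1_card; apply: eq_bigl => J.
by rewrite inE andbT.
Qed.

(** * Moebius inversion of the Hoeffding recursion *)

Section Restriction.
Variables (n r : nat).
Implicit Types I : subsets n r.

Lemma val_indices I : indices I = enum (val I) :> seq 'I_n.
Proof. by rewrite /indices val_tcast. Qed.

Lemma indices_inj I : injective (tnth (indices I)).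
Proof. by apply/tuple_uniqP; rewrite val_indices enum_uniq. Qed.

Lemma mem_indices I x : (x \in indices I) = (x \in val I).
Proof. by rewrite -[x \in indices I]/(x \in tval _) val_indices mem_enum. Qed.

Lemma imset_indices I : (tnth (indices I) @: [set: 'I_r])%SET = val I.
Proof.
apply/finset.setP => x; rewrite -mem_indices; apply/imsetP/tnthP => -[i].
  by move=> _ ->; exists i.
by move=> ->; exists i.
Qed.

End Restriction.

Lemma sorted_enum_ord (n : nat) (A : {set 'I_n}) :
  sorted (fun i j : 'I_n => i < j)%N (enum A).
Proof.
have -> : enum A = [seq x <- enum 'I_n | x \in A] by rewrite enumT.
apply: sorted_filter; first by move=> i j k; exact: ltn_trans.
by have := iota_ltn_sorted 0 n; rewrite -val_enum_ord sorted_map.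
Qed.

(** Increasing enumerations compose to an increasing one, and a strictly sorted list is determined
    by its elements. *)
Lemma restrict_restrict (T : Type) (n r l : nat) (z : n.-tuple T)
    (I : subsets n r) (J : subsets r l) (K : subsets n l) :
  val K = (tnth (indices I) @: val J)%SET ->
  Defs.restrict (Defs.restrict z I) J = Defs.restrict z K.
Proof.
move=> KE; apply: eq_from_tnth => i; rewrite !tnth_mktuple; congr (tnth z _).
have: map (tnth (indices I)) (indices J) = indices K.
  apply: (@irr_sorted_eq _ (fun i j : 'I_n => i < j)%N).
  - by move=> a b c; exact: ltn_trans.
  - by move=> a; rewrite ltnn.
  - rewrite val_indices; have := sorted_enum_ord (val J).
    apply: homo_sorted => a b ab.
    have x0 := tnth (indices I) a; rewrite !(tnth_nth x0).
    have := sorted_enum_ord (val I); rewrite -val_indices => sI.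
    by apply: (sorted_ltn_nth (leT := fun i j : 'I_n => (i < j)%N) _ x0 sI);
      rewrite ?inE ?size_tuple //; move=> p q s; exact: ltn_trans.
  - by rewrite val_indices; exact: sorted_enum_ord.
  - move=> x; rewrite mem_indices KE; apply/mapP/imsetP => -[j jJ ->]; exists j => //.
      by rewrite -mem_indices.
    by rewrite mem_indices.
move/(congr1 (fun s => nth (tnth (indices K) i) s i)).
rewrite -tnth_nth => <-; rewrite (nth_map (tnth (indices J) i)) ?size_tuple //.
by rewrite -tnth_nth.
Qed.

(** Reading the size off the set lets sums run over subsets of all sizes at once. *)
Definition to_subsets (n : nat) (A : {set 'I_n}) : subsets n #|A| :=
  exist _ A (eqxx _).

(** Replaces the length [l] by the cardinality without a cast, as [F] is defined at every length. *)
Lemma restrict_val (T V : Type) (n l : nat) (F : forall j, j.-tuple T -> V)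
    (z : n.-tuple T) (J : subsets n l) :
  F l (Defs.restrict z J) = F _ (Defs.restrict z (to_subsets (val J))).
Proof.
case: J => A p /=; have e := eqP p; subst l.
by congr (F _ (Defs.restrict z _)); apply: val_inj.
Qed.

Lemma restrict_setT (T : Type) (n : nat) (z : n.-tuple T) (I : subsets n n) :
  Defs.restrict z I = z.
Proof.
have IT : val I = [set: 'I_n]%SET.
  by apply/eqP; rewrite eqEcard finset.subsetT cardsT card_ord (eqP (valP I)) /=.
apply: eq_from_tnth => i; rewrite tnth_mktuple; congr (tnth z _).
rewrite (tnth_nth i) val_indices IT enum_setT -enumT; exact: nth_ord_enum.
Qed.

Lemma val_restrict (T : Type) (n l : nat) (z : n.-tuple T) (I : subsets n l) :
  Defs.restrict z I = [seq tnth z i | i <- enum (val I)] :> seq T.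
Proof. by rewrite /= (map_comp (tnth z)) map_tnth_enum val_indices. Qed.

Section HoeffdingMoebius.
Context {d dS : measure_display} {Omega : measurableType d}
  {S : measurableType dS} {R : realType} {P : probability Omega R}.
Variables (r : nat) (Z : 'I_r -> {RV P >-> S}) (h : r.-tuple S -> R).
Local Open Scope ring_scope.

(** The recursion accounts for C = A. Proper subsets of A are the images, under the increasing
    enumeration [e] of A, of the subsets of [|A|] with fewer than |A| elements, and nested
    restrictions compose. *)
Lemma sum_sub_hoeffding (z : r.-tuple S) (A : {set 'I_r}) :
  \sum_(C : {set 'I_r} | C \subset A)
    hoeffding Z h (Defs.restrict z (to_subsets C)) =
  gproj Z h (Defs.restrict z (to_subsets A)).
Proof.
rewrite (bigD1 A) //= hoeffdingE -[RHS]addr0 -addrA; congr (_ + _).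
apply/eqP; rewrite addrC subr_eq0; apply/eqP.
pose e := tnth (indices (to_subsets A)).
pose H C := hoeffding Z h (Defs.restrict z (to_subsets C)).
have eI : injective e by exact: indices_inj.
transitivity (\sum_(B : {set 'I_#|A|} | (#|B| < #|A|)%N) H (e @: B)%SET); last first.
  rewrite [LHS](partition_big (fun B : {set 'I_#|A|} => inord #|B| : 'I_#|A|.+1)
    (fun l => l < #|A|)%N) /=; last first.
    by move=> B BA; rewrite inordK // ltnS ltnW.
  rewrite big_ord_narrow ?leqnSn //=.
  apply/esym; apply: eq_bigr => l _.
  rewrite (eq_bigr (fun I : subsets #|A| l => H (e @: val I)%SET)); last first.
    move=> I _.
    have cI : #|(e @: val I)%SET| == l by rewrite card_imset // (eqP (valP I)).
    rewrite (@restrict_restrict _ _ _ _ z (to_subsets A) I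
      (exist (fun B : {set 'I_r} => #|B| == l) _ cI)) //.
    exact: (restrict_val (fun j => @hoeffding _ _ _ _ _ _ _ Z h j)).
  rewrite (big_subsets _ l xpredT (fun B => H (e @: B)%SET)).
  apply: eq_bigl => B; rewrite andbT -val_eqE /=.
  case: (ltnP #|B| #|A|) => BA /=; first by rewrite inordK // ltnS ltnW.
  by apply/negbTE; rewrite neq_ltn (leq_trans (ltn_ord l) BA) orbT.
rewrite -[RHS](big_imset H (A := [pred B : {set 'I_#|A|} | (#|B| < #|A|)%N])
  (h := fun B : {set _} => (e @: B)%SET)); last first.
  by move=> B C _ _ /(imset_inj eI).
have eA : (e @: [set: 'I_#|A|])%SET = A := imset_indices (to_subsets A).
apply: eq_bigl => C; apply/andP/imsetP => [[CA CnA]|[B BA ->]]; last first.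
  split; first by have := imsetS e (finset.subsetT B); rewrite eA.
  by apply: contraTneq BA => E; rewrite unfold_in -ltnNge -[in ltnLHS]E card_imset.
have CE : C = (e @: (e @^-1: C))%SET.
  apply/finset.setP => x; apply/idP/imsetP => [xC|[i + ->]]; last by rewrite inE.
  have : x \in (e @: [set: 'I_#|A|])%SET by rewrite eA (fintype.subsetP CA).
  by move=> /imsetP[i _ xE]; exists i => //; rewrite inE -xE.
exists (e @^-1: C)%SET => //.
rewrite unfold_in -(card_imset _ eI) -CE.
by apply: proper_card; rewrite finset.properEneq CnA.
Qed.

Lemma hoeffding_top (z : r.-tuple S) :
  hoeffding Z h z = \sum_(B : {set 'I_r})
     (-1) ^+ (r - #|B|) * gproj Z h (Defs.restrict z (to_subsets B)).
Proof.
rewrite -(moebius_subsets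
  (H := fun C => hoeffding Z h (Defs.restrict z (to_subsets C)))); last first.
  exact: sum_sub_hoeffding.
have cT : #|[set: 'I_r]%SET| == r by rewrite cardsT card_ord.
rewrite -(restrict_val (fun j => @hoeffding _ _ _ _ _ _ _ Z h j) z
  (exist (fun B : {set 'I_r} => #|B| == r) _ cT)).
by rewrite restrict_setT.
Qed.

End HoeffdingMoebius.

(** * Moments *)

Section Mean.
Context {R : realType} {d : measure_display} {T : measurableType d}.
Variable P : probability T R.
Local Open Scope classical_set_scope.
Local Open Scope ring_scope.

(** Integrability is bundled with the value, so that linear combinations need no separate
    argument. *)
Definition has_mean (f : T -> R) (m : R) : Prop :=
  P.-integrable setT (EFin \o f) /\ (\int[P]_w (f w)%:E = m%:E)%E.

Lemma has_mean0 : has_mean (fun=> 0) 0.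
Proof. by split; [exact: integrable0|rewrite integral0]. Qed.

Lemma has_meanD (f g : T -> R) (m k : R) :
  has_mean f m -> has_mean g k -> has_mean (fun w => f w + g w) (m + k).
Proof.
move=> [fi fm] [gi gk]; split; first exact: (integrableD measurableT fi gi).
under eq_integral => w _ do rewrite EFinD.
by rewrite (integralD measurableT fi gi) /= fm gk.
Qed.

Lemma has_mean_sum (I : finType) (Q : pred I) (f : I -> T -> R) (m : I -> R) :
  (forall i, Q i -> has_mean (f i) (m i)) ->
  has_mean (fun w => \sum_(i | Q i) f i w) (\sum_(i | Q i) m i).
Proof.
move=> H; elim: (index_enum I) => [|i s IH].
  by under eq_fun do rewrite big_nil; rewrite big_nil; exact: has_mean0.
under eq_fun do rewrite big_cons; rewrite big_cons.
by case: ifP => [Qi|_] //; apply: has_meanD => //; exact: H.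
Qed.

Lemma has_meanZ (f : T -> R) (m c : R) :
  has_mean f m -> has_mean (fun w => c * f w) (c * m).
Proof.
move=> [fi fm]; split; first exact: (integrableZl measurableT c fi).
under eq_integral => w _ do rewrite EFinM.
by rewrite (integralZl measurableT fi) /= fm EFinM.
Qed.

(** Domination: |f g| <= f^2 + g^2. *)
Lemma integrable_mul_sqr (f g : T -> R) :
  measurable_fun setT f -> measurable_fun setT g ->
  P.-integrable setT (fun w => (f w * f w)%:E) ->
  P.-integrable setT (fun w => (g w * g w)%:E) ->
  P.-integrable setT (fun w => (f w * g w)%:E).
Proof.
move=> mf mg f2 g2; have := integrableD measurableT f2 g2.
apply: le_integrable => //.
  by apply/measurable_EFinP; exact: measurable_funM.
move=> w _; rewrite -EFinD !abse_EFin lee_fin normrM.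
rewrite (ger0_norm (_ : 0 <= f w * f w + g w * g w)); last first.
  by rewrite addr_ge0 // -expr2 sqr_ge0.
rewrite -!expr2 -(real_normK (num_real (f w))) -(real_normK (num_real (g w))).
by have := sqr_ge0 (`|f w| - `|g w|); have := normr_ge0 (f w);
  have := normr_ge0 (g w); nra.
Qed.

End Mean.

(** * Argument lists completed by fresh copies *)

Section Mix.
Variables (r : nat) (K : finType) (a : 'I_r -> K).

(* The argument list of the kernel in g_j evaluated along A: the first #|A|
   slots carry the elements of A (through a), the others fresh copies. *)
Definition mix (b : 'I_r -> K) (A : {set 'I_r}) (i : 'I_r) : K :=
  nth (b i) [seq a x | x <- enum A] i.

(** Gives [mix] the shape in which [gproj] writes its arguments, the default of [nth] supplying the
    fresh copy. *)
Lemma mix_apply (V : Type) (f : K -> V) (b : 'I_r -> K) (A : {set 'I_r})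
    (i : 'I_r) :
  f (mix b A i) = nth (f (b i)) [seq f (a x) | x <- enum A] i.
Proof.
rewrite /mix; have [iA|iA] := ltnP i (size (enum A)).
  by rewrite !(nth_map i).
by rewrite !nth_default ?size_map.
Qed.

Hypothesis a_inj : injective a.

(** The equation on [i] in [MixOld] ties a slot to the element it holds; injectivity of [mix] rests
    on it. *)
Variant mix_spec (b : 'I_r -> K) (A : {set 'I_r}) (i : 'I_r) : K -> Prop :=
| MixOld p of p \in A & i = index p (enum A) :> nat : mix_spec b A i (a p)
| MixNew : mix_spec b A i (b i).

Lemma mixP (b : 'I_r -> K) (A : {set 'I_r}) (i : 'I_r) :
  mix_spec b A i (mix b A i).
Proof.
rewrite /mix; have [iA|iA] := ltnP i (size (enum A)).
  rewrite (nth_map i) //; apply: MixOld; first by rewrite -mem_enum mem_nth.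
  by rewrite index_uniq // enum_uniq.
by rewrite nth_default ?size_map //; exact: MixNew.
Qed.

Lemma mix_inj (b : 'I_r -> K) (A : {set 'I_r}) :
  injective b -> (forall i j, a i != b j) -> injective (mix b A).
Proof.
move=> bI ab i j.
case: mixP => [p pA ip|]; case: mixP => [q qA jq|].
- by move=> /a_inj pq; apply: val_inj; rewrite /= ip jq pq.
- by move=> /eqP; rewrite (negbTE (ab _ _)).
- by move=> /esym/eqP; rewrite (negbTE (ab _ _)).
- exact: bI.
Qed.

Lemma mem_imset_mix (b : 'I_r -> K) (A : {set 'I_r}) (p : 'I_r) :
  p \in A -> a p \in (mix b A @: [set: 'I_r])%SET.
Proof.
move=> pA; have pi : (index p (enum A) < size (enum A))%N.
  by rewrite index_mem mem_enum.
have pr : (index p (enum A) < r)%N.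
  by apply: leq_trans pi _; rewrite -cardE -[leqRHS]card_ord max_card.
apply/imsetP; exists (Ordinal pr) => //.
by rewrite /mix (nth_map p) //= nth_index // mem_enum.
Qed.

(** Fresh values meet neither the old ones nor each other, so only old values can be shared. *)
Lemma overlap_mix (b c : 'I_r -> K) (A B : {set 'I_r}) :
  (forall i j, a i != b j) -> (forall i j, a i != c j) ->
  (forall i j, b i != c j) ->
  overlap (mix b A) (mix c B) = #|A :&: B|%SET.
Proof.
move=> ab ac bc; rewrite /overlap -(card_imset _ a_inj); apply: eq_card => x.
apply/setIP/imsetP => [[/imsetP[i _ ->] /imsetP[j _]]|[p]].
  case: mixP => [p pA _|]; case: mixP => [q qB _|] => /eqP.
  - by rewrite (inj_eq a_inj) => /eqP pq; exists p; rewrite // inE pA pq qB.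
  - by rewrite (negbTE (ac _ _)).
  - by rewrite eq_sym (negbTE (ab _ _)).
  - by rewrite (negbTE (bc _ _)).
by rewrite inE => /andP[pA pB] ->; split; exact: mem_imset_mix.
Qed.

End Mix.

(** * Means of the estimator and of the squared top component *)

Section OverlapMoments.
Context {R : realType} {d d0 dS : measure_display}
  {Omega : measurableType d} {P : probability Omega R}
  {Omega0 : measurableType d0} {P0 : probability Omega0 R}
  {S : measurableType dS}.
Variables (r n : nat) (hn : (2 * r <= n)%N).
Variables (Z0 : {RV P0 >-> S}) (Z : 'I_n -> {RV P >-> S}).
Hypothesis hZ : iid_copies Z0 Z.
Local Open Scope classical_set_scope.
Local Open Scope ring_scope.

Let mu : probability S R := distribution P0 Z0.
Let iota (i : 'I_r) : 'I_n := widen_ord (leq_double_l hn) i.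
Let Zr (i : 'I_r) : {RV P >-> S} := Z (iota i).
Let X (i : 'I_n) : Omega -> S := Z i.

Lemma iid_family_copies : iid_family mu P X.
Proof.
split; first by move=> k; exact: measurable_funP.
move=> B mB; have [iZ dZ] := hZ.
have := iZ [set: 'I_n]%SET B mB.
have -> : \bigcap_(i in [set` [set: 'I_n]%SET]) Z i @^-1` B i =
    [set w | forall k, B k (X k w)].
  apply/seteqP; split=> w /= h k; first by apply: (h k); rewrite /= inE.
  by move=> _; exact: h.
move=> ->; apply: eq_big => [i|i _]; first by rewrite inE.
exact: (dZ i (B i) (mB i)).
Qed.

(** The first copy carries the arguments of both projections; the second and third are the
    integration variables of one projection each. *)
Let P3 := product_probability P (product_probability P P).
Let W := sum_family X (sum_family X X).

Lemma iid_family_triple : iid_family mu P3 W.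
Proof.
apply: (iid_sum_family (P2 := product_probability P P) iid_family_copies).
exact: (iid_sum_family iid_family_copies iid_family_copies).
Qed.

Let old (i : 'I_r) : 'I_n + ('I_n + 'I_n) := inl (iota i).
Let new1 (i : 'I_r) : 'I_n + ('I_n + 'I_n) := inr (inl (iota i)).
Let new2 (i : 'I_r) : 'I_n + ('I_n + 'I_n) := inr (inr (iota i)).

Let iota_inj : injective iota.
Proof. by move=> i j /(congr1 val) /= /val_inj. Qed.
Let old_inj : injective old. Proof. by move=> i j [] /val_inj. Qed.
Let new1_inj : injective new1. Proof. by move=> i j [] /val_inj. Qed.
Let new2_inj : injective new2. Proof. by move=> i j [] /val_inj. Qed.

Section TwoKernels.
Variables h1 h2 : r.-tuple S -> R.
Hypotheses (mh1 : measurable_fun [set: r.-tuple S] h1)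
  (mh2 : measurable_fun [set: r.-tuple S] h2).
Hypotheses (sh1 : symmetric_kernel h1) (sh2 : symmetric_kernel h2).
Hypotheses
  (L1 : P.-integrable setT
     (fun w => (h1 (tuple_map X iota w) * h1 (tuple_map X iota w))%:E))
  (L2 : P.-integrable setT
     (fun w => (h2 (tuple_map X iota w) * h2 (tuple_map X iota w))%:E)).

Lemma overlap_self (K : finType) (u : 'I_r -> K) :
  injective u -> overlap u u = r.
Proof.
by move=> uI; rewrite /overlap finset.setIid card_imset // cardsT card_ord.
Qed.

Lemma iid_square_integrable (dT : measure_display) (T : measurableType dT)
    (Q : probability T R) (K : finType) (Y : K -> T -> S) (v : 'I_r -> K)
    (g : r.-tuple S -> R) :
  iid_family mu Q Y -> injective v -> measurable_fun [set: r.-tuple S] g ->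
  symmetric_kernel g ->
  P.-integrable setT
     (fun w => (g (tuple_map X iota w) * g (tuple_map X iota w))%:E) ->
  Q.-integrable setT
     (fun w => (g (tuple_map Y v w) * g (tuple_map Y v w))%:E).
Proof.
move=> iY vI mg sg Lg.
have E : overlap iota iota = overlap v v by rewrite !overlap_self.
exact: (eq_iid_kernel_product iid_family_copies iY mg mg sg sg
  iota_inj iota_inj vI vI E Lg).1.
Qed.

(** Square integrability gives integrability by pairing [g] with the constant 1. *)
Lemma iid_integrable (dT : measure_display) (T : measurableType dT)
    (Q : probability T R) (K : finType) (Y : K -> T -> S) (v : 'I_r -> K)
    (g : r.-tuple S -> R) :
  iid_family mu Q Y -> injective v -> measurable_fun [set: r.-tuple S] g ->
  symmetric_kernel g ->
  P.-integrable setT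
     (fun w => (g (tuple_map X iota w) * g (tuple_map X iota w))%:E) ->
  Q.-integrable setT (fun w => (g (tuple_map Y v w))%:E).
Proof.
move=> iY vI mg sg Lg.
under eq_fun => w do rewrite -[g _]mulr1.
apply: (integrable_mul_sqr (g := cst 1)) => //.
- exact: (measurableT_comp mg (measurable_tuple_map v iY.1)).
- exact: iid_square_integrable.
- have -> : (fun w => (cst 1 w * cst 1 w)%:E) = EFin \o (cst 1 : T -> R).
    by apply: funext => w /=; rewrite mulr1.
  exact: finite_measure_integrable_cst.
Qed.

Lemma iid_product_integrable (dT : measure_display) (T : measurableType dT)
    (Q : probability T R) (K : finType) (Y : K -> T -> S) (v v' : 'I_r -> K) :
  iid_family mu Q Y -> injective v -> injective v' ->
  Q.-integrable setT
     (fun w => (h1 (tuple_map Y v w) * h2 (tuple_map Y v' w))%:E).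
Proof.
move=> iY vI v'I; apply: integrable_mul_sqr.
- exact: (measurableT_comp mh1 (measurable_tuple_map v iY.1)).
- exact: (measurableT_comp mh2 (measurable_tuple_map v' iY.1)).
- exact: iid_square_integrable.
- exact: iid_square_integrable.
Qed.

(* E{h1(Z_I) h2(Z_J)} for |I n J| = s, realized on three independent copies
   of the sample. *)
Definition overlap_moment (s : nat) : R :=
  let A := [set i : 'I_r | (i < s)%N]%SET in
  fine (\int[P3]_w (h1 (tuple_map W (mix old new1 A) w)
                    * h2 (tuple_map W (mix old new2 A) w))%:E)%E.

(** The mean depends on the lists through their overlap only, so any pair may be replaced by the
    canonical one in [overlap_moment]. *)
Lemma has_mean_overlap (dT : measure_display) (T : measurableType dT)
    (Q : probability T R) (K : finType) (Y : K -> T -> S) (v v' : 'I_r -> K) :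
  iid_family mu Q Y -> injective v -> injective v' ->
  has_mean Q (fun w => h1 (tuple_map Y v w) * h2 (tuple_map Y v' w))
    (overlap_moment (overlap v v')).
Proof.
move=> iY vI v'I.
(* The two mixes along this initial segment share exactly [overlap v v'] variables. *)
set A := [set i : 'I_r | (i < overlap v v')%N]%SET.
have uI : injective (mix old new1 A) by exact: mix_inj.
have u'I : injective (mix old new2 A) by exact: mix_inj.
have ov : overlap (mix old new1 A) (mix old new2 A) = overlap v v'.
  rewrite overlap_mix // finset.setIid.
  have sr : (overlap v v' <= r)%N.
    rewrite -[leqRHS](overlap_self vI) /overlap finset.setIid.
    by rewrite subset_leq_card // finset.subsetIl.
  rewrite -sum1_card; under eq_bigl => i do rewrite inE.
  by rewrite (big_ord_narrow sr) sum1_card card_ord.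
have i3 := iid_product_integrable iid_family_triple uI u'I.
have [iQ E] := eq_iid_kernel_product iid_family_triple iY mh1 mh2 sh1 sh2
  uI u'I vI v'I ov i3.
split; first exact: iQ.
by rewrite E /overlap_moment fineK //; exact: (integrable_fin_num measurableT i3).
Qed.

(** Presents the projection as a partial integral of a function on Omega x Omega, the form used by
    [integral_decoupling]. *)
Lemma gproj_restrict (g : r.-tuple S -> R) (A : {set 'I_r}) (w : Omega) :
  gproj Zr g (Defs.restrict (sample Zr w) (to_subsets A)) =
  fine (\int[P]_w' (g (tuple_map (sum_family X X)
     (mix (inl \o iota) (inr \o iota) A) (w, w')))%:E)%E.
Proof.
rewrite /gproj unlock; congr fine; apply: eq_integral => w' _; congr (g _)%:E.
apply: eq_from_tnth => i; rewrite !tnth_mktuple.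
rewrite (mix_apply _ (fun k => sum_family X X k (w, w'))) val_restrict /=.
by congr nth; apply: eq_map => x; rewrite tnth_mktuple.
Qed.

(** Decoupling rewrites the mean as an integral over three copies, where the kernels are evaluated
    at mixes along A and B; these share |A n B| variables. *)
Lemma has_mean_gproj (A B : {set 'I_r}) :
  has_mean P (fun w =>
      gproj Zr h1 (Defs.restrict (sample Zr w) (to_subsets A)) *
      gproj Zr h2 (Defs.restrict (sample Zr w) (to_subsets B)))
    (overlap_moment #|A :&: B|%SET).
Proof.
have uI : injective (mix old new1 A) by exact: mix_inj.
have vI : injective (mix old new2 B) by exact: mix_inj.
have := has_mean_overlap iid_family_triple uI vI.
rewrite overlap_mix // => -[i3 m3].
pose F (g : r.-tuple S -> R) (A : {set 'I_r}) (z : Omega * Omega) :=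
  g (tuple_map (sum_family X X) (mix (inl \o iota) (inr \o iota) A) z).
have iXX := iid_sum_family iid_family_copies iid_family_copies.
have cI : injective (mix (inl \o iota) (inr \o iota : _ -> 'I_n + 'I_n) A).
  by apply: mix_inj => // i j [] /val_inj.
have c'I : injective (mix (inl \o iota) (inr \o iota : _ -> 'I_n + 'I_n) B).
  by apply: mix_inj => // i j [] /val_inj.
(* A mixed tuple on the triple product reads the first coordinate and only one of the other two. *)
have FE g C new z (y : Omega) :
    (forall i, W (new i) z = X (iota i) y) ->
    g (tuple_map W (mix old new C) z) = F g C (z.1, y).
  move=> newE; congr g; apply: eq_from_tnth => i; rewrite !tnth_mktuple.
  rewrite (mix_apply _ (fun k => W k z)) newE.
  by rewrite (mix_apply _ (fun k => sum_family X X k (z.1, y))).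
have FE12 : (fun z => (h1 (tuple_map W (mix old new1 A) z) *
                       h2 (tuple_map W (mix old new2 B) z))%:E) =
    (fun z => (F h1 A (z.1, z.2.1) * F h2 B (z.1, z.2.2))%:E).
  by apply: funext => z; rewrite (FE _ _ _ _ z.2.1) // (FE _ _ _ _ z.2.2).
have [] := @integral_decoupling _ _ _ _ _ P P (F h1 A) (F h2 B).
- exact: (@iid_integrable _ _ (product_probability P P)).
- exact: (@iid_integrable _ _ (product_probability P P)).
- by rewrite -FE12; exact: i3.
move=> iG mG; split.
  by apply: eq_integrable iG => // w _ /=; rewrite !gproj_restrict.
under eq_integral => w _ do rewrite !gproj_restrict.
rewrite mG -m3; apply: eq_integral => z _.
exact: (esym (congr1 (@^~ z) FE12)).
Qed.

End TwoKernels.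

Section OneKernel.
Variable h : r.-tuple S -> R.
Hypotheses (mh : measurable_fun [set: r.-tuple S] h) (sh : symmetric_kernel h).
Hypothesis L : P.-integrable setT
  (fun w => (h (tuple_map X iota w) * h (tuple_map X iota w))%:E).

Let h_r (w : Omega) : R := hoeffding Zr h (sample Zr w).
(** The common value through which the two means are compared. *)
Let sigma2 : R :=
  \sum_(s < r.+1) (-1) ^+ (r - s) * 'C(r, s)%:R * overlap_moment h h s.

Lemma has_mean_sigma2_hat : has_mean P (sigma2_hat Z h) sigma2.
Proof.
have HI w (I : subsets n r) :
    kernel_array Z h w I = h (tuple_map X (tnth (indices I)) w).
  rewrite ffunE; congr h; apply: eq_from_tnth => i.
  by rewrite !tnth_mktuple.
have HIJ (I J : subsets n r) :
    has_mean P (fun w => kernel_array Z h w I * kernel_array Z h w J)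
      (overlap_moment h h #|val I :&: val J|%SET).
  have := has_mean_overlap mh mh sh sh L L iid_family_copies
    (@indices_inj _ _ I) (@indices_inj _ _ J).
  rewrite /overlap !imset_indices.
  by under eq_fun => w do rewrite -!HI.
rewrite /sigma2_hat /Tdir.
(* For each s there are [npairs n r s] equal means, which cancel the normalization; this number is
   nonzero because 2r <= n. *)
rewrite (_ : sigma2 = \sum_(s < r.+1)
    (-1) ^+ (r - s) * 'C(r, s)%:R * (npairs n r s)%:R^-1 *
    \sum_(I : subsets n r) \sum_(J : subsets n r | #|val I :&: val J|%SET == s)
      overlap_moment h h s); last first.
  apply: eq_bigr => s _; have sr : (s <= r)%N := ltn_ord s.
  rewrite sum_overlap_const //.
  rewrite -[overlap_moment _ _ _ *+ _]mulr_natl mulrA mulfVK //.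
  have rn := leq_double_l hn.
  by rewrite pnatr_eq0 -lt0n !muln_gt0 !bin_gt0 rn sr /=; lia.
apply: has_mean_sum => s _; apply: has_meanZ.
apply: has_mean_sum => I _; apply: has_mean_sum => J /eqP <-.
exact: HIJ.
Qed.

Lemma has_mean_sqr_hoeffding : has_mean P (fun w => h_r w ^+ 2) sigma2.
Proof.
rewrite /sigma2 -alternating_sum_overlap.
under eq_fun => w.
  rewrite expr2 {1}/h_r hoeffding_top big_distrl /=.
  under eq_bigr => A _ do rewrite /h_r hoeffding_top big_distrr /=.
  over.
apply: has_mean_sum => A _; apply: has_mean_sum => B _.
under eq_fun => w do rewrite -mulrA [X in _ * X]mulrCA.
apply: has_meanZ; apply: has_meanZ.
exact: has_mean_gproj.
Qed.

(** Pairing [h] with the constant kernel 1 and the empty set shows that all projections have the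
    same mean. The signs over the subsets of the nonempty set [r] then cancel. *)
Lemma has_mean_hoeffding : (1 <= r)%N -> has_mean P h_r 0.
Proof.
move=> hr.
have m1 : measurable_fun [set: r.-tuple S] (cst (1 : R)) by exact: measurable_cst.
have s1 : symmetric_kernel (cst 1 : r.-tuple S -> R) by [].
have L1 : P.-integrable setT (fun w =>
    ((cst 1 : r.-tuple S -> R) (tuple_map X iota w) *
     (cst 1 : r.-tuple S -> R) (tuple_map X iota w))%:E).
  have -> : (fun w => ((cst 1 : r.-tuple S -> R) (tuple_map X iota w) *
     (cst 1 : r.-tuple S -> R) (tuple_map X iota w))%:E) =
     EFin \o (cst 1 : Omega -> R) by apply: funext => w /=; rewrite mulr1.
  exact: finite_measure_integrable_cst.
have mG (B : {set 'I_r}) : has_mean P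
    (fun w => gproj Zr h (Defs.restrict (sample Zr w) (to_subsets B)))
    (overlap_moment h (cst 1) 0).
  have := has_mean_gproj mh m1 sh s1 L L1 B finset.set0.
  under eq_fun => w.
    rewrite [X in _ * X](_ : _ = 1) ?mulr1; last first.
      by rewrite /gproj -[RHS]/(fine 1%:E); congr fine; exact: expectation_cst.
    over.
  by rewrite finset.setI0 cards0.
have -> : 0 = \sum_(B : {set 'I_r})
    (-1) ^+ (r - #|B|) * overlap_moment h (cst 1) 0.
  rewrite (reindex_inj (can_inj (@finset.setCK _))) /=.
  under eq_bigr => B _ do rewrite sign_setC finset.setCK.
  rewrite (alternating_sum_setI (A := finset.set0)
    (fun=> overlap_moment h (cst 1) 0)) //.
  by rewrite eq_sym -card_gt0 cardsT card_ord.
rewrite /h_r; under eq_fun => w do rewrite hoeffding_top.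
by apply: has_mean_sum => B _; apply: has_meanZ.
Qed.

Lemma mean_sigma2_hat :
  P.-integrable setT (EFin \o sigma2_hat Z h) /\
  ('E_P[sigma2_hat Z h] = 'E_P[fun w => (h_r w ^+ 2)%R])%E.
Proof.
have [i1 E1] := has_mean_sigma2_hat; have [_ E2] := has_mean_sqr_hoeffding.
by split=> //; rewrite !unlock E1 -E2.
Qed.

Lemma variance_hoeffding : (1 <= r)%N ->
  ('E_P[fun w => (h_r w ^+ 2)%R] = 'V_P[h_r])%E.
Proof.
move=> hr; have [_ E0] := has_mean_hoeffding hr.
rewrite /variance covariance.unlock.
have -> : 'E_P[h_r]%E = 0%E by rewrite unlock.
congr ('E_P[ _ ])%E; apply: funext => w.
by rewrite -[RHS]/((h_r w - 0) * (h_r w - 0)) subr0 expr2.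
Qed.

End OneKernel.

End OverlapMoments.

(** * The estimator: projection identity, unbiasedness, nonnegativity *)

Theorem mainTheorem7 (R : realType) (d d0 dS : measure_display)
  (Omega : measurableType d) (P : probability Omega R)
  (Omega0 : measurableType d0) (P0 : probability Omega0 R)
  (S : measurableType dS)
  (r n : nat) (hr : (1 <= r)%N) (hn : (2 * r <= n)%N)
  (Z0 : {RV P0 >-> S}) (Z : 'I_n -> {RV P >-> S})
  (hZ : iid_copies Z0 Z)
  (h : r.-tuple S -> R)
  (h_meas : measurable_fun [set: r.-tuple S]%classic h)
  (h_sym : symmetric_kernel h) :
  let Zr := fun i : 'I_r => Z (widen_ord (leq_double_l hn) i) in
  ('E_P[fun w => (h (sample Zr w) ^+ 2)%R] < +oo)%E ->
  let h_r := fun w : Omega => hoeffding Zr h (sample Zr w) in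
  let sigma2_r := ('E_P[fun w => (h_r w ^+ 2)%R])%E in
  [/\ forall w : Omega,
        sigma2_hat Z h w
        = ((dimd R n r)^-1 * sqnorm (Uop (kernel_array Z h w)))%R,
      P.-integrable [set: Omega]%classic (EFin \o sigma2_hat Z h)
        /\ ('E_P[sigma2_hat Z h] = sigma2_r)%E,
      (sigma2_r = 'V_P[h_r])%E
    & forall w : Omega, (0 <= sigma2_hat Z h w)%R].
Proof.
move=> Zr hfin h_r sigma2_r.
(* As h^2 is measurable and nonnegative, its finite expectation amounts to integrability. *)
have L : P.-integrable [set: Omega]%classic (fun w =>
    (h (tuple_map (fun i => Z i : Omega -> S)
          (widen_ord (leq_double_l hn)) w) *
     h (tuple_map (fun i => Z i : Omega -> S)
          (widen_ord (leq_double_l hn)) w))%:E)%R.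
  have mZ : measurable_fun [set: Omega]%classic
      (tuple_map (fun i => Z i : Omega -> S) (widen_ord (leq_double_l hn))).
    by apply: measurable_tuple_map => k; exact: measurable_funP.
  apply/integrableP; split.
    by apply/measurable_EFinP; apply: measurable_funM;
      exact: (measurableT_comp h_meas mZ).
  move: hfin; rewrite unlock; congr (_ < _)%E; apply: eq_integral => w _.
  by rewrite /= ger0_norm -expr2 ?sqr_ge0.
split.
- by move=> w; exact: Tdir_projection.
- exact: (mean_sigma2_hat hZ h_meas h_sym L).
- exact: (variance_hoeffding hZ h_meas h_sym L hr).
- by move=> w; exact: Tdir_ge0.
Qed.
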